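(* Consider the generalised ant with rule word $w = LLRRRL$ (so $|w|=6$). Then: (1) there exists a finite configuration from which this ant is in a highway whose drift is not a multiple of $(1,1)$ or of $(1,-1)$ (a non-diagonal highway); (2) there exists a finite configuration from which this ant has an increasing rectangle behaviour; (3) there exist infinitely many pairwise inequivalent diagonal highways of this ant, each of which the ant is in from some finite configuration.
   Context: Let $Q=\{(0,1),(1,0),(0,-1),(-1,0)\}$ be the set of directions, with counterclockwise rotation $t^{\circlearrowleft}$ and clockwise rotation $t^{\circlearrowright}$ (rotations by $\pm 90^\circ$). For a word $w\in\{L,R\}^*$, an ant configuration is a triple $(c,(i,j),q)$ with $c\in\{0,\dots,|w|-1\}^{\mathbb{Z}^2}$, $(i,j)\in\mathbb{Z}^2$, $q\in Q$. The generalised ant $T_w$ maps $(c,(i,j),q)$ to $(c',(i',j'),q')$ where, with $k=c_{i,j}$: $q'=t^{\circlearrowright}(q)$ if $w_k=R$ and $q'=t^{\circlearrowleft}(q)$ if $w_k=L$; $(i',j')=(i,j)+q'$; $c'_{i,j}=c_{i,j}+1 \bmod |w|$; $c'_{k,l}=c_{k,l}$ for $(k,l)\ne(i,j)$. A configuration is finite if $c$ has only finitely many nonzero cells. The trace from $C$ is the sequence of cell states $c_{i,j}$ read by the ant at successive steps (an element of $\{0,\dots,|w|-1\}^{\mathbb{N}}$) and the trajectory is the sequence $(\mathbf{y}_n)_{n\in\mathbb{N}}$ of its positions. Highway: the ant is in a highway of period $n$ and drift $(a,b)$ from $C$ if $C$ is finite, the trace $x$ satisfies $x_{i+n}=x_i$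 for all $i$ (with $n$ minimal), and the trajectory satisfies $\mathbf{y}_{i+n}=\mathbf{y}_i+(a,b)$ for all $i$. Two highways are equivalent if their traces and trajectories coincide after removing a finite prefix from both. A highway is diagonal if its drift is a multiple of $(\pm1,\pm1)$. Interlaced word: $x\in\mathcal{A}^{\mathbb{N}}$ is interlaced if there exist $k\ge 1$ and words $u_i,v_i\in\mathcal{A}^*$ ($0\le i<k$) with $x=t_0t_1t_2\cdots$ where $t_n=u_0v_0^n u_1 v_1^n\cdots u_{k-1}v_{k-1}^n$. Previsible trajectory: for a compact $\Delta\subset\mathbb{R}^2$ containing $0$, a trajectory $\mathbf{y}$ is $\Delta$-previsible if there exist non-decreasing $f,g:\mathbb{N}\to\mathbb{R}^+$, an integer $k$ and a nonzero vector $\vec d\in\mathbb{R}^2$ such that (i) for all $n$, $\mathbf{y}_n\in\partial_k(f(n)\Delta+g(n)\vec d)$, and (ii) for every $p\in\partial\Delta$ and every $N$ there is $n\ge N$ with $d(\mathbf{y}_n, f(n)p+g(n)\vec d)\le k$. Here $f(n)X+g(n)\vec d$ is the dilation of $X$ by $f(n)$ about $0$ translated by $g(n)\vec d$, $\partial X$ is the boundary and $\partial_k X$ the set of points at distance at most $k$ from $\partial X$. The behaviour is increasing if $f(n)\to+\infty$ and drifting if $g(n)\to+\infty$ (non-drifting otherwise). Emergent behaviour from $C$: the trace is eventually interlaced and the trajectory is $\Delta$-previsible for some compact $\Delta$. Increasing rectangle behaviour: an increasing, non-drifting emergent behaviour where $\Delta$ is a rectangle. *)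

(* Defs.v *)
From Stdlib Require Import Reals ZArith List Arith.
Import ListNotations.
Local Open Scope R_scope.

Inductive letter : Type := TurnL | TurnR.

Inductive dir : Type := DN | DE | DS | DW.

Definition dir_vec (q : dir) : Z * Z :=
  match q with
  | DN => (0%Z, 1%Z) | DE => (1%Z, 0%Z) | DS => (0%Z, (-1)%Z) | DW => ((-1)%Z, 0%Z)
  end.

Definition rot_cw (q : dir) : dir :=
  match q with DN => DE | DE => DS | DS => DW | DW => DN end.
Definition rot_ccw (q : dir) : dir :=
  match q with DN => DW | DW => DS | DS => DE | DE => DN end.

Record ant_config : Type := mkConfig {
  cells : Z * Z -> nat;
  pos : Z * Z;
  heading : dir }.

Definition addZ2 (p q : Z * Z) : Z * Z := (fst p + fst q, snd p + snd q)%Z.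

Definition cell_update (c : Z * Z -> nat) (p : Z * Z) (v : nat) : Z * Z -> nat :=
  fun p' => if (Z.eqb (fst p') (fst p) && Z.eqb (snd p') (snd p))%bool then v else c p'.

Definition ant_step (w : list letter) (C : ant_config) : ant_config :=
  let k := cells C (pos C) in
  let q' := match nth k w TurnL with
            | TurnR => rot_cw (heading C)
            | TurnL => rot_ccw (heading C)
            end in
  mkConfig (cell_update (cells C) (pos C) ((k + 1) mod length w))
           (addZ2 (pos C) (dir_vec q')) q'.

Definition ant_iter (w : list letter) (n : nat) (C : ant_config) : ant_config :=
  Nat.iter n (ant_step w) C.

Definition valid_config (w : list letter) (C : ant_config) : Prop :=
  forall p, (cells C p < length w)%nat.

Definition finite_config (w : list letter) (C : ant_config) : Prop :=
  valid_config w C /\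
  exists S : list (Z * Z), forall p, ~ In p S -> cells C p = 0%nat.

Definition trace (w : list letter) (C : ant_config) (n : nat) : nat :=
  let D := ant_iter w n C in cells D (pos D).

Definition trajectory (w : list letter) (C : ant_config) (n : nat) : Z * Z :=
  pos (ant_iter w n C).

Definition is_highway (w : list letter) (C : ant_config) (n : nat) (a b : Z) : Prop :=
  finite_config w C /\
  (0 < n)%nat /\
  (forall i, trace w C (i + n) = trace w C i) /\
  (forall m, (0 < m < n)%nat -> ~ (forall i, trace w C (i + m) = trace w C i)) /\
  (forall i, trajectory w C (i + n) = addZ2 (trajectory w C i) (a, b)).

Definition diagonal_drift (a b : Z) : Prop := a = b \/ a = (- b)%Z.

Definition highway_equiv (w : list letter) (C1 C2 : ant_config) : Prop :=
  exists (m1 m2 : nat) (t : Z * Z), forall i,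
    trace w C1 (m1 + i) = trace w C2 (m2 + i) /\
    trajectory w C1 (m1 + i) = addZ2 (trajectory w C2 (m2 + i)) t.

Definition interlace_block (uv : list (list nat * list nat)) (n : nat) : list nat :=
  flat_map (fun p => fst p ++ concat (repeat (snd p) n)) uv.

Definition interlace_prefix (uv : list (list nat * list nat)) (N : nat) : list nat :=
  concat (map (interlace_block uv) (seq 0 N)).

(** x = t_0 t_1 t_2 ... with t_n = u_0 v_0^n ... u_{k-1} v_{k-1}^n, k >= 1 *)
Definition interlaced (x : nat -> nat) : Prop :=
  exists uv : list (list nat * list nat),
    uv <> [] /\
    (forall N i, (i < length (interlace_prefix uv N))%nat ->
                 x i = nth i (interlace_prefix uv N) 0%nat) /\
    (forall M, exists N, (M <= length (interlace_prefix uv N))%nat).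

Definition eventually_interlaced (x : nat -> nat) : Prop :=
  exists m, interlaced (fun i => x (m + i)%nat).

Definition pt := (R * R)%type.

Definition dist2 (p q : pt) : R :=
  sqrt ((fst p - fst q)^2 + (snd p - snd q)^2).

Definition toR2 (p : Z * Z) : pt := (IZR (fst p), IZR (snd p)).

Definition boundary (X : pt -> Prop) (p : pt) : Prop :=
  forall eps : R, 0 < eps ->
    (exists q, X q /\ dist2 p q < eps) /\ (exists q, ~ X q /\ dist2 p q < eps).

Definition near_boundary (k : R) (X : pt -> Prop) (p : pt) : Prop :=
  exists q, boundary X q /\ dist2 p q <= k.

Definition dil_trans (f g : R) (d : pt) (X : pt -> Prop) : pt -> Prop :=
  fun p => exists q, X q /\ p = (f * fst q + g * fst d, f * snd q + g * snd d).

Definition closed_set (X : pt -> Prop) : Prop :=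
  forall p, (forall eps, 0 < eps -> exists q, X q /\ dist2 p q < eps) -> X p.

Definition bounded_set (X : pt -> Prop) : Prop :=
  exists M, forall p, X p -> dist2 p (0, 0) <= M.

(** compact subsets of R^2 (Heine-Borel) *)
Definition compact_set (X : pt -> Prop) : Prop := closed_set X /\ bounded_set X.

Definition nondecreasing (f : nat -> R) : Prop := forall m n, (m <= n)%nat -> f m <= f n.

Definition tends_to_infty (f : nat -> R) : Prop :=
  forall M, exists N, forall n, (N <= n)%nat -> M <= f n.

Definition previsible_with (Delta : pt -> Prop) (y : nat -> Z * Z)
    (f g : nat -> R) (k : Z) (d : pt) : Prop :=
  (forall n, 0 <= f n) /\ (forall n, 0 <= g n) /\
  nondecreasing f /\ nondecreasing g /\
  d <> (0, 0) /\
  (forall n, near_boundary (IZR k) (dil_trans (f n) (g n) d Delta) (toR2 (y n))) /\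
  (forall p, boundary Delta p -> forall N, exists n, (N <= n)%nat /\
      dist2 (toR2 (y n)) (f n * fst p + g n * fst d, f n * snd p + g n * snd d)
        <= IZR k).

Definition is_rectangle (Delta : pt -> Prop) : Prop :=
  exists (c u v : pt),
    u <> (0, 0) /\ v <> (0, 0) /\ fst u * fst v + snd u * snd v = 0 /\
    forall z, Delta z <-> exists s t, 0 <= s <= 1 /\ 0 <= t <= 1 /\
       z = (fst c + s * fst u + t * fst v, snd c + s * snd u + t * snd v).

(** Increasing rectangle behaviour from C: increasing, non-drifting emergent
    behaviour with Delta a rectangle. *)
Definition increasing_rectangle_behaviour (w : list letter) (C : ant_config) : Prop :=
  eventually_interlaced (trace w C) /\
  exists (Delta : pt -> Prop) (f g : nat -> R) (k : Z) (d : pt),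
    compact_set Delta /\ Delta (0, 0) /\ is_rectangle Delta /\
    previsible_with Delta (trajectory w C) f g k d /\
    tends_to_infty f /\ ~ tends_to_infty g.

Definition w_LLRRRL : list letter := [TurnL; TurnL; TurnR; TurnR; TurnR; TurnL].

(* Main.v *)
From Stdlib Require Import String Reals ZArith List Lia Lra Bool Wf_nat Classical_Prop.
Require Import Defs.
Import ListNotations.

(** Locality turns a run on a finite table into a statement about infinitely many
    configurations: the ant only sees the cells it visits, so the run is reproduced, translated,
    by every configuration that agrees with the table on the visited region. If a table contains
    a two-cell wide block that the ant traverses and leaves on the other side, then in the
    configuration where the block is repeated [K] times the ant makes [K] traversals.

    The vertical highway comes from a single table. The diagonal highways come from one table in
    which a block of the horizontal front is repeated [K] times: the period is [1472 + 96 K] and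
    the drift is [(4, 4)], so the speeds are pairwise different.

    In the growing square, the ant winds counterclockwise around a square of cells in state 4,
    zigzagging on two rows whose outer cells turn it left and whose inner cells turn it
    right. Two turns push every side outwards by one cell; a seam near the bottom
    left corner moves the ant to the next ring. After four turns all sides have moved by two
    cells and the pattern near the four corners has reproduced itself, so the [n]-th such cycle is
    obtained from a table by repeating [2 n + 1] times a block on each side. *)

Local Open Scope Z_scope.

Definition scaleZ2 (j : Z) (u : Z * Z) : Z * Z := (j * fst u, j * snd u).

Definition nth_shift (t u : Z * Z) (i : nat) : Z * Z := addZ2 t (scaleZ2 (Z.of_nat i) u).

Lemma Z2_eq_iff (p q : Z * Z) : p = q <-> fst p = fst q /\ snd p = snd q.
Proof. destruct p, q; cbn. split; [now intros [= -> ->]|now intros [-> ->]]. Qed.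

Ltac z2_lia :=
  repeat match goal with H : @eq (Z * Z) _ _ |- _ => apply Z2_eq_iff in H end;
  rewrite ?Z2_eq_iff; unfold nth_shift, addZ2, scaleZ2 in *; cbn [fst snd] in *; lia.

Lemma Z2_eq_dec (p q : Z * Z) : {p = q} + {p <> q}.
Proof. decide equality; apply Z.eq_dec. Defined.

Lemma addZ2_0_r p : addZ2 p (0, 0) = p.
Proof. z2_lia. Qed.

Lemma addZ2_cancel_r p q t : addZ2 p t = addZ2 q t -> p = q.
Proof. intros Heq. z2_lia. Qed.

Lemma cell_update_eq c p v : cell_update c p v p = v.
Proof. unfold cell_update. now rewrite !Z.eqb_refl. Qed.

Lemma cell_update_neq c p v q : q <> p -> cell_update c p v q = c q.
Proof.
  intros Hne. unfold cell_update.
  destruct (Z.eqb_spec (fst q) (fst p)), (Z.eqb_spec (snd q) (snd p)); cbn; try reflexivity.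
  exfalso. apply Hne. now apply Z2_eq_iff.
Qed.

(** * Runs *)

Lemma ant_iter_add w m n C : ant_iter w (m + n) C = ant_iter w m (ant_iter w n C).
Proof. apply Nat.iter_add. Qed.

Lemma ant_iter_succ_r w n C : ant_iter w (S n) C = ant_iter w n (ant_step w C).
Proof. apply Nat.iter_succ_r. Qed.

Lemma trace_add w m i C : trace w C (m + i) = trace w (ant_iter w m C) i.
Proof. unfold trace. now rewrite Nat.add_comm, ant_iter_add. Qed.

Lemma trajectory_add w m i C : trajectory w C (m + i) = trajectory w (ant_iter w m C) i.
Proof. unfold trajectory. now rewrite Nat.add_comm, ant_iter_add. Qed.

Inductive runs (w : list letter) (V : Z * Z -> Prop) :
    ant_config -> list nat -> ant_config -> Prop :=
| runs_nil C : runs w V C [] C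
| runs_cons C tr C' :
    V (pos C) -> runs w V (ant_step w C) tr C' -> runs w V C (cells C (pos C) :: tr) C'.

Lemma runs_app w V C tr1 C1 tr2 C2 :
  runs w V C tr1 C1 -> runs w V C1 tr2 C2 -> runs w V C (tr1 ++ tr2) C2.
Proof. induction 1; cbn [app]; auto using runs_cons. Qed.

Lemma runs_weaken w (V V' : Z * Z -> Prop) C tr C' :
  (forall p, V p -> V' p) -> runs w V C tr C' -> runs w V' C tr C'.
Proof. intros Hsub. induction 1; auto using runs_nil, runs_cons. Qed.

Lemma runs_end {w V C tr C'} : runs w V C tr C' -> ant_iter w (length tr) C = C'.
Proof.
  induction 1; cbn [length]; [reflexivity|]. now rewrite ant_iter_succ_r.
Qed.

Lemma runs_trace {w V C tr C'} i :
  runs w V C tr C' -> (i < length tr)%nat -> trace w C i = nth i tr 0%nat.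
Proof.
  intros Hrun. revert i. induction Hrun as [|C tr C' HV Hrun IH]; cbn [length]; intros i Hi; [lia|].
  destruct i as [|i]; [reflexivity|].
  unfold trace. rewrite ant_iter_succ_r. apply IH. lia.
Qed.

Lemma runs_trajectory {w V C tr C'} i :
  runs w V C tr C' -> (i < length tr)%nat -> V (trajectory w C i).
Proof.
  intros Hrun. revert i. induction Hrun as [|C tr C' HV Hrun IH]; cbn [length]; intros i Hi; [lia|].
  destruct i as [|i]; [assumption|].
  unfold trajectory. rewrite ant_iter_succ_r. apply IH. lia.
Qed.

Lemma runs_unvisited {w V C tr C'} p : runs w V C tr C' -> ~ V p -> cells C' p = cells C p.
Proof.
  intros Hrun Hp. induction Hrun as [|C tr C' HV Hrun IH]; [reflexivity|].
  rewrite IH. apply cell_update_neq. now intros ->.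
Qed.

(** * Translated configurations *)

Definition cells_agree (D : Z * Z -> bool) (t : Z * Z) (c1 c2 : Z * Z -> nat) : Prop :=
  forall p, D p = true -> c1 (addZ2 p t) = c2 p.

Definition docked (t : Z * Z) (C1 C2 : ant_config) : Prop :=
  pos C1 = addZ2 (pos C2) t /\ heading C1 = heading C2.

Lemma docked_dec t C1 C2 : {docked t C1 C2} + {~ docked t C1 C2}.
Proof.
  destruct (Z2_eq_dec (pos C1) (addZ2 (pos C2) t)) as [Hpos|Hpos]; [|right; now intros []].
  assert (Hdir : {heading C1 = heading C2} + {heading C1 <> heading C2}) by decide equality.
  destruct Hdir as [Hhead|Hhead]; [left; now split|right; now intros []].
Defined.

Definition dockedb (t : Z * Z) (C1 C2 : ant_config) : bool :=
  if docked_dec t C1 C2 then true else false.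

Lemma dockedb_docked t C1 C2 : dockedb t C1 C2 = true -> docked t C1 C2.
Proof. unfold dockedb. now destruct (docked_dec t C1 C2). Qed.

Lemma docked_trans {t t' C1 C2 C3} :
  docked t C1 C2 -> docked t' C2 C3 -> docked (addZ2 t t') C1 C3.
Proof. intros [Hp Hh] [Hp' Hh']. split; [z2_lia|congruence]. Qed.

Lemma ant_step_translate w {D t C1 C2} :
  docked t C1 C2 -> cells_agree D t (cells C1) (cells C2) -> D (pos C2) = true ->
  docked t (ant_step w C1) (ant_step w C2) /\
  cells_agree D t (cells (ant_step w C1)) (cells (ant_step w C2)).
Proof.
  intros [Hpos Hhead] Hcells HD.
  assert (Hread : cells C1 (pos C1) = cells C2 (pos C2)) by (rewrite Hpos; auto).
  unfold ant_step, docked. rewrite Hread, Hhead. cbn [pos heading cells].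
  split; [split; [z2_lia|reflexivity]|].
  intros p Hp. destruct (Z2_eq_dec p (pos C2)) as [->|Hne].
  - now rewrite <- Hpos, !cell_update_eq.
  - rewrite !cell_update_neq; auto. rewrite Hpos. intros Heq. now apply addZ2_cancel_r in Heq.
Qed.

(** * Highways *)

Definition drifts (w : list letter) (C : ant_config) (n : nat) (d : Z * Z) : Prop :=
  forall i, trace w C (i + n) = trace w C i /\
            trajectory w C (i + n) = addZ2 (trajectory w C i) d.

(* Only the cells of [R], a region that the drift maps into itself, matter for the future. *)
Lemma drifts_of_run w C tr C' d (R : Z * Z -> bool) :
  runs w (fun p => R p = true) C tr C' -> tr <> [] ->
  (forall p, R p = true -> R (addZ2 p d) = true) ->
  docked d C' C -> cells_agree R d (cells C') (cells C) ->
  drifts w C (length tr) d.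
Proof.
  intros Hrun Hne HR Hdock Hcells. set (n := length tr).
  assert (Hn : (0 < n)%nat) by (destruct tr; [congruence|cbn in n; lia]).
  assert (Hperiodic : forall m i, (i <= m)%nat ->
    R (trajectory w C i) = true /\
    docked d (ant_iter w (i + n) C) (ant_iter w i C) /\
    cells_agree R d (cells (ant_iter w (i + n) C)) (cells (ant_iter w i C))).
  { induction m as [|m IH]; intros i Hi.
    - replace i with 0%nat by lia. cbn [Nat.add]. unfold n at 1 2. rewrite (runs_end Hrun).
      split; [now apply (runs_trajectory 0 Hrun)|now split].
    - destruct i as [|i]; [apply IH; lia|].
      destruct (IH i) as (HVi & Hdi & Hci); [lia|].
      split; [|now apply ant_step_translate].
      destruct (Nat.lt_ge_cases (S i) n) as [Hlt|Hge];
        [now apply (runs_trajectory _ Hrun)|].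
      destruct (IH (S i - n)%nat) as (HVj & [Hpos _] & _); [lia|].
      replace (S i - n + n)%nat with (S i) in Hpos by lia.
      unfold trajectory. rewrite Hpos. now apply HR. }
  intros i. destruct (Hperiodic i i (Nat.le_refl i)) as (HV & [Hpos _] & Hci).
  split; [|exact Hpos]. unfold trace. rewrite Hpos. now apply Hci.
Qed.

Lemma drifts_iter {w C n d} k i : drifts w C n d ->
  trajectory w C (i + k * n) = addZ2 (trajectory w C i) (scaleZ2 (Z.of_nat k) d).
Proof.
  intros Hdrift. induction k as [|k IH].
  - rewrite Nat.add_0_r. z2_lia.
  - replace (i + S k * n)%nat with (i + k * n + n)%nat by lia.
    rewrite (proj2 (Hdrift _)), IH, Nat2Z.inj_succ. z2_lia.
Qed.

Definition turn (w : list letter) (k : nat) (q : dir) : dir :=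
  match nth k w TurnL with TurnR => rot_cw q | TurnL => rot_ccw q end.

Lemma heading_succ w C i :
  heading (ant_iter w (S i) C) = turn w (trace w C i) (heading (ant_iter w i C)).
Proof. reflexivity. Qed.

Lemma trajectory_succ w C i :
  trajectory w C (S i) = addZ2 (trajectory w C i) (dir_vec (heading (ant_iter w (S i) C))).
Proof. reflexivity. Qed.

Definition rotate_cw (v : Z * Z) : Z * Z := (snd v, - fst v).

Lemma turn_iter_rot_cw w k j q :
  turn w k (Nat.iter j rot_cw q) = Nat.iter j rot_cw (turn w k q).
Proof.
  induction j as [|j IH]; [reflexivity|]. rewrite !Nat.iter_succ, <- IH.
  unfold turn. now destruct (nth k w TurnL), (Nat.iter j rot_cw q).
Qed.

Lemma dir_vec_iter_rot_cw j q :
  dir_vec (Nat.iter j rot_cw q) = Nat.iter j rotate_cw (dir_vec q).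
Proof.
  induction j as [|j IH]; [reflexivity|]. rewrite !Nat.iter_succ, <- IH.
  now destruct (Nat.iter j rot_cw q).
Qed.

Lemma iter_rotate_cw_add j u v :
  Nat.iter j rotate_cw (addZ2 u v) = addZ2 (Nat.iter j rotate_cw u) (Nat.iter j rotate_cw v).
Proof.
  induction j as [|j IH]; [reflexivity|]. rewrite !Nat.iter_succ, IH. unfold rotate_cw. z2_lia.
Qed.

Lemma rot_cw_transitive q q' : exists j, (j < 4)%nat /\ q' = Nat.iter j rot_cw q.
Proof.
  destruct q, q';
    first [exists 0%nat; split; [lia|reflexivity]|exists 1%nat; split; [lia|reflexivity]
          |exists 2%nat; split; [lia|reflexivity]|exists 3%nat; split; [lia|reflexivity]].
Qed.

Lemma rotate_cw_fixed j d : (j < 4)%nat -> Nat.iter j rotate_cw d = d -> d <> (0, 0) -> j = 0%nat.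
Proof.
  intros Hj Hfix Hd. destruct d as [a b].
  destruct j as [|[|[|[|j]]]]; [reflexivity| | | |lia];
    exfalso; apply Hd; cbn in Hfix; injection Hfix; intros; f_equal; lia.
Qed.

Lemma same_trace_heading {w j C1 C2} :
  (forall i, trace w C1 i = trace w C2 i) -> heading C1 = Nat.iter j rot_cw (heading C2) ->
  forall i, heading (ant_iter w i C1) = Nat.iter j rot_cw (heading (ant_iter w i C2)).
Proof.
  intros Htrace Hhead. induction i as [|i IH]; [exact Hhead|].
  now rewrite !heading_succ, Htrace, IH, turn_iter_rot_cw.
Qed.

Lemma same_trace_trajectory w j C1 C2 :
  (forall i, trace w C1 i = trace w C2 i) -> heading C1 = Nat.iter j rot_cw (heading C2) ->
  exists v, forall i, trajectory w C1 i = addZ2 (Nat.iter j rotate_cw (trajectory w C2 i)) v.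
Proof.
  intros Htrace Hhead.
  exists (addZ2 (pos C1) (scaleZ2 (-1) (Nat.iter j rotate_cw (pos C2)))).
  induction i as [|i IH].
  - change (trajectory w C1 0) with (pos C1). change (trajectory w C2 0) with (pos C2). z2_lia.
  - rewrite !trajectory_succ, IH, (same_trace_heading Htrace Hhead),
      dir_vec_iter_rot_cw, iter_rotate_cw_add. z2_lia.
Qed.

(* A period of the trace may rotate the heading, but the rotation then fixes the drift. *)
Lemma trace_period_drifts {w C n d} m :
  drifts w C n d -> d <> (0, 0) -> (forall i, trace w C (i + m) = trace w C i) ->
  exists d', drifts w C m d'.
Proof.
  intros Hdrift Hd Hperiod.
  destruct (rot_cw_transitive (heading C) (heading (ant_iter w m C))) as (j & Hj & Hhead).
  destruct (same_trace_trajectory w j (ant_iter w m C) C) as [v Hv].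
  { intros i. rewrite <- trace_add, Nat.add_comm. apply Hperiod. }
  { exact Hhead. }
  assert (Hrot : forall i,
    trajectory w C (i + m) = addZ2 (Nat.iter j rotate_cw (trajectory w C i)) v).
  { intros i. now rewrite <- Hv, <- trajectory_add, Nat.add_comm. }
  assert (Hfix : Nat.iter j rotate_cw d = d).
  { pose proof (proj2 (Hdrift (0 + m)%nat)) as Hthere.
    replace (0 + m + n)%nat with (0 + n + m)%nat in Hthere by lia.
    rewrite !Hrot, (proj2 (Hdrift 0%nat)), iter_rotate_cw_add in Hthere. z2_lia. }
  apply rotate_cw_fixed in Hfix; auto. subst j.
  exists v. intros i. split; [apply Hperiod|apply Hrot].
Qed.

Lemma drifts_highway w C n d :
  finite_config w C -> (0 < n)%nat -> drifts w C n d -> d <> (0, 0) ->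
  exists m a b, is_highway w C m a b /\
    scaleZ2 (Z.of_nat n) (a, b) = scaleZ2 (Z.of_nat m) d.
Proof.
  intros Hfin Hn Hdrift Hd.
  set (period := fun m => (0 < m)%nat /\ forall i, trace w C (i + m) = trace w C i).
  destruct (dec_inh_nat_subset_has_unique_least_element period) as (m & [[Hm Hperiod] Hmin] & _).
  { intros k. apply classic. }
  { exists n. split; [assumption|]. intros i. apply Hdrift. }
  destruct (trace_period_drifts m Hdrift Hd Hperiod) as [[a b] Hdrift'].
  exists m, a, b. split.
  - repeat split; try apply Hfin; auto.
    + intros k Hk Hk'. specialize (Hmin k (conj (proj1 Hk) Hk')). lia.
    + intros i. apply Hdrift'.
  - pose proof (drifts_iter m 0 Hdrift) as Heq.
    rewrite Nat.mul_comm, (drifts_iter n 0 Hdrift') in Heq. z2_lia.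
Qed.

Lemma highway_equiv_period w C1 C2 n1 n2 d :
  drifts w C1 n1 d -> drifts w C2 n2 d -> d <> (0, 0) -> highway_equiv w C1 C2 -> n1 = n2.
Proof.
  intros Hdrift1 Hdrift2 Hd (m1 & m2 & t & Hequiv).
  pose proof (proj2 (Hequiv 0%nat)) as Hstart.
  pose proof (proj2 (Hequiv (n1 * n2)%nat)) as Hlater.
  rewrite !Nat.add_0_r in Hstart. rewrite (Nat.mul_comm n1 n2) in Hlater at 1.
  rewrite (drifts_iter _ _ Hdrift1), (drifts_iter _ _ Hdrift2), Hstart in Hlater.
  destruct (Nat.eq_dec n1 n2) as [|Hne]; [assumption|exfalso; apply Hd].
  apply Z2_eq_iff in Hlater. unfold addZ2, scaleZ2 in Hlater. cbn [fst snd] in Hlater.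
  apply Z2_eq_iff. cbn [fst snd]. nia.
Qed.

(** * Simulation on finite tables *)

(* Row [y] of a table lists the states of the cells [(0, y), (1, y), ...]; all other cells
   are in state 0. *)
Definition table : Type := list (list nat).

Definition read (t : table) (p : Z * Z) : nat :=
  if (fst p <? 0) || (snd p <? 0) then 0%nat
  else nth (Z.to_nat (fst p)) (nth (Z.to_nat (snd p)) t []) 0%nat.

Fixpoint set_nth {A : Type} (n : nat) (v : A) (l : list A) : list A :=
  match l, n with
  | [], _ => []
  | _ :: l', 0%nat => v :: l'
  | a :: l', S n' => a :: set_nth n' v l'
  end.

Lemma nth_set_nth {A : Type} n (v : A) l m d :
  (n < length l)%nat ->
  nth m (set_nth n v l) d = if Nat.eqb m n then v else nth m l d.
Proof.
  revert n m. induction l as [|a l IH]; intros n m Hn; cbn in Hn; [lia|].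
  destruct n, m; cbn; auto. apply IH. lia.
Qed.

Definition in_table (t : table) (p : Z * Z) : bool :=
  (0 <=? fst p) && (0 <=? snd p) &&
  (Z.to_nat (snd p) <? length t)%nat &&
  (Z.to_nat (fst p) <? length (nth (Z.to_nat (snd p)) t []))%nat.

Definition write (t : table) (p : Z * Z) (v : nat) : table :=
  set_nth (Z.to_nat (snd p)) (set_nth (Z.to_nat (fst p)) v (nth (Z.to_nat (snd p)) t [])) t.

Lemma read_write t p v q : in_table t p = true ->
  read (write t p v) q = cell_update (read t) p v q.
Proof.
  destruct p as [x y], q as [x' y']. unfold in_table, read, write, cell_update; cbn [fst snd].
  rewrite !andb_true_iff, !Z.leb_le, !Nat.ltb_lt. intros [[[Hx Hy] Hy'] Hx'].
  destruct (Z.ltb_spec x' 0); cbn [orb].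
  { destruct (Z.eqb_spec x' x); [lia|reflexivity]. }
  destruct (Z.ltb_spec y' 0); cbn [orb].
  { destruct (Z.eqb_spec y' y); [lia|]. now rewrite andb_false_r. }
  rewrite nth_set_nth by assumption.
  destruct (Z.eqb_spec y' y) as [->|Hne].
  - rewrite Nat.eqb_refl, nth_set_nth by assumption.
    rewrite andb_true_r. destruct (Z.eqb_spec x' x) as [->|Hne].
    + now rewrite Nat.eqb_refl.
    + destruct (Nat.eqb_spec (Z.to_nat x') (Z.to_nat x)); [lia|reflexivity].
  - rewrite andb_false_r.
    destruct (Nat.eqb_spec (Z.to_nat y') (Z.to_nat y)); [lia|reflexivity].
Qed.

Record tconfig : Type := TConfig { tab : table; tpos : Z * Z; thead : dir }.

Definition config_of (s : tconfig) : ant_config := mkConfig (read (tab s)) (tpos s) (thead s).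

Definition table_step (w : list letter) (s : tconfig) : tconfig :=
  let k := read (tab s) (tpos s) in
  let q := turn w k (thead s) in
  TConfig (write (tab s) (tpos s) ((k + 1) mod length w)) (addZ2 (tpos s) (dir_vec q)) q.

Fixpoint table_run (w : list letter) (Q : Z * Z -> bool) (n : nat) (s : tconfig)
    : option (list nat * tconfig) :=
  match n with
  | 0%nat => Some ([], s)
  | S n' =>
      if Q (tpos s) && in_table (tab s) (tpos s) then
        match table_run w Q n' (table_step w s) with
        | Some (tr, s') => Some (read (tab s) (tpos s) :: tr, s')
        | None => None
        end
      else None
  end.

Lemma table_run_succ {w Q n s tr s'} : table_run w Q (S n) s = Some (tr, s') ->
  Q (tpos s) = true /\ in_table (tab s) (tpos s) = true /\
  exists tr', tr = read (tab s) (tpos s) :: tr' /\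
    table_run w Q n (table_step w s) = Some (tr', s').
Proof.
  cbn. destruct (Q (tpos s)), (in_table (tab s) (tpos s)); cbn; try discriminate.
  destruct (table_run w Q n (table_step w s)) as [[tr' s1]|]; [|discriminate].
  intros [= <- <-]. eauto.
Qed.

Lemma table_run_length {w Q n s tr s'} : table_run w Q n s = Some (tr, s') -> length tr = n.
Proof.
  revert s tr. induction n as [|n IH]; intros s tr Hrun; [now injection Hrun as <-|].
  apply table_run_succ in Hrun. destruct Hrun as (_ & _ & tr' & -> & Hrun).
  cbn. f_equal. exact (IH _ _ Hrun).
Qed.

Lemma table_run_unvisited {w Q n s tr s'} p :
  table_run w Q n s = Some (tr, s') -> Q p = false -> read (tab s') p = read (tab s) p.
Proof.
  intros Hrun Hp. revert s tr Hrun. induction n as [|n IH]; intros s tr Hrun;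
    [now injection Hrun as _ <-|].
  apply table_run_succ in Hrun. destruct Hrun as (HQ & Hin & tr' & -> & Hrun).
  rewrite (IH _ _ Hrun). cbn [table_step tab]. rewrite read_write by assumption.
  apply cell_update_neq. intros ->. congruence.
Qed.

Lemma outside_larger (Q D : Z * Z -> bool) p :
  (forall q, Q q = true -> D q = true) -> D p = false -> Q p = false.
Proof. intros Hsub Hp. apply not_true_is_false. intros HQ. apply Hsub in HQ. congruence. Qed.

Definition placed (Q : Z * Z -> bool) (t p : Z * Z) : Prop :=
  exists q, Q q = true /\ p = addZ2 q t.

Lemma not_placed Q t p : Q p = false -> ~ placed Q t (addZ2 p t).
Proof. intros HQ (q & Hq & Heq). apply addZ2_cancel_r in Heq. congruence. Qed.

Lemma table_run_sound {w Q n s tr s'} (D : Z * Z -> bool) C t :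
  table_run w Q n s = Some (tr, s') -> (forall p, Q p = true -> D p = true) ->
  docked t C (config_of s) -> cells_agree D t (cells C) (read (tab s)) ->
  exists C', runs w (placed Q t) C tr C' /\
    docked t C' (config_of s') /\ cells_agree D t (cells C') (read (tab s')).
Proof.
  intros Hrun Hsub. revert s tr C Hrun.
  induction n as [|n IH]; intros s tr C Hrun Hdock Hcells.
  - injection Hrun as <- <-. exists C. split; [apply runs_nil|now split].
  - apply table_run_succ in Hrun. destruct Hrun as (HQ & Hin & tr' & -> & Hrun).
    destruct (ant_step_translate w Hdock Hcells (Hsub _ HQ)) as [Hdock1 Hcells1].
    destruct (IH _ _ (ant_step w C) Hrun) as (C' & Hrest & Hdock' & Hcells').
    + exact Hdock1.
    + intros p Hp. rewrite (Hcells1 p Hp). symmetry. now apply read_write.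
    + exists C'. split; [|now split].
      replace (read (tab s) (tpos s)) with (cells C (pos C))
        by (rewrite (proj1 Hdock); now apply Hcells, Hsub).
      apply runs_cons; [|assumption].
      exists (tpos s). split; [assumption|apply Hdock].
Qed.

Lemma cells_agree_unvisited {w V C tr C'} D t c : runs w V C tr C' ->
  (forall p, D p = true -> ~ V (addZ2 p t)) ->
  cells_agree D t (cells C) c -> cells_agree D t (cells C') c.
Proof.
  intros Hrun HV Hcells p Hp. rewrite (runs_unvisited _ Hrun) by auto. now apply Hcells.
Qed.

Lemma cells_agree_elsewhere {w Q n s tr s' V C trs C'} D t :
  table_run w Q n s = Some (tr, s') -> runs w V C trs C' ->
  (forall p, D p = true -> Q p = false /\ ~ V (addZ2 p t)) ->
  cells_agree D t (cells C) (read (tab s)) -> cells_agree D t (cells C') (read (tab s')).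
Proof.
  intros Hrun Hruns Hapart Hcells p Hp. destruct (Hapart p Hp) as [HQ HV].
  rewrite (runs_unvisited _ Hruns HV), (table_run_unvisited _ Hrun HQ). now apply Hcells.
Qed.

Lemma docked_config_of s : docked (0, 0) (config_of s) (config_of s).
Proof. split; [symmetry; apply addZ2_0_r|reflexivity]. Qed.

Lemma cells_agree_config_of D s : cells_agree D (0, 0) (cells (config_of s)) (read (tab s)).
Proof. intros p _. now rewrite addZ2_0_r. Qed.

(** * Decidable comparison of tables *)

Definition zrange (a : Z) (n : nat) : list Z := map (fun i => a + Z.of_nat i) (seq 0 n).

Lemma in_zrange a n x : a <= x < a + Z.of_nat n -> In x (zrange a n).
Proof.
  intros Hx. apply in_map_iff. exists (Z.to_nat (x - a)). split; [lia|].
  apply in_seq. lia.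
Qed.

Definition width (t : table) : nat := list_max (map (@length nat) t).

Lemma read_outside t x y :
  ~ (0 <= x < Z.of_nat (width t) /\ 0 <= y < Z.of_nat (length t)) -> read t (x, y) = 0%nat.
Proof.
  unfold read. cbn [fst snd]. intros Hout.
  destruct (Z.ltb_spec x 0); [reflexivity|]. destruct (Z.ltb_spec y 0); [reflexivity|]. cbn [orb].
  destruct (Nat.lt_ge_cases (Z.to_nat y) (length t)) as [Hy|Hy].
  - apply nth_overflow.
    assert (Hmax : Forall (fun k => (k <= width t)%nat) (map (@length nat) t))
      by now apply list_max_le.
    rewrite Forall_forall in Hmax.
    specialize (Hmax _ (in_map (@length nat) _ _ (nth_In t [] Hy))). lia.
  - rewrite (nth_overflow t) by assumption. now destruct (Z.to_nat x).
Qed.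

(* Outside the box searched here both tables read 0. *)
Definition shift_check (D : Z * Z -> bool) (d : Z * Z) (t t' : table) : bool :=
  let m := Z.max (Z.abs (fst d)) (Z.abs (snd d)) in
  forallb (fun p => negb (D p) || (read t' (addZ2 p d) =? read t p)%nat)
    (list_prod (zrange (- m) (Nat.max (width t) (width t') + 2 * Z.to_nat m))
               (zrange (- m) (Nat.max (length t) (length t') + 2 * Z.to_nat m))).

Lemma shift_check_spec D d t t' p :
  shift_check D d t t' = true -> D p = true -> read t' (addZ2 p d) = read t p.
Proof.
  unfold shift_check. set (m := Z.max _ _). destruct p as [x y]. intros Hcheck HD.
  destruct (in_dec Z2_eq_dec (x, y)
    (list_prod (zrange (- m) (Nat.max (width t) (width t') + 2 * Z.to_nat m))
               (zrange (- m) (Nat.max (length t) (length t') + 2 * Z.to_nat m)))) as [Hin|Hout].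
  - rewrite forallb_forall in Hcheck. specialize (Hcheck _ Hin). rewrite HD in Hcheck.
    now apply Nat.eqb_eq.
  - assert (Hbox : ~ (- m <= x < - m + Z.of_nat (Nat.max (width t) (width t') + 2 * Z.to_nat m) /\
                      - m <= y < - m + Z.of_nat (Nat.max (length t) (length t') + 2 * Z.to_nat m)))
      by (intros [Hx Hy]; apply Hout, in_prod; now apply in_zrange).
    unfold addZ2. cbn [fst snd]. rewrite !read_outside; [reflexivity|lia|lia].
Qed.

Definition states_below (k : nat) (t : table) : bool := forallb (forallb (fun v => (v <? k)%nat)) t.

Lemma read_states_below k t p : (0 < k)%nat -> states_below k t = true -> (read t p < k)%nat.
Proof.
  intros Hk Ht. unfold read. destruct (_ || _); [assumption|].
  unfold states_below in Ht. rewrite forallb_forall in Ht.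
  destruct (nth_in_or_default (Z.to_nat (snd p)) t []) as [Hrow| ->].
  - specialize (Ht _ Hrow). rewrite forallb_forall in Ht.
    destruct (nth_in_or_default (Z.to_nat (fst p)) (nth (Z.to_nat (snd p)) t []) 0%nat)
      as [Hcell| ->]; [|assumption].
    now apply Nat.ltb_lt, Ht.
  - now destruct (Z.to_nat (fst p)).
Qed.

Lemma finite_config_of_box w C (W H : nat) :
  valid_config w C ->
  (forall x y, ~ (0 <= x < Z.of_nat W /\ 0 <= y < Z.of_nat H) -> cells C (x, y) = 0%nat) ->
  finite_config w C.
Proof.
  intros Hvalid Hout. split; [assumption|].
  exists (list_prod (zrange 0 W) (zrange 0 H)). intros [x y] Hnin. apply Hout.
  intros [Hx Hy]. apply Hnin, in_prod; apply in_zrange; lia.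
Qed.

Lemma config_of_finite w s :
  (0 < length w)%nat -> states_below (length w) (tab s) = true -> finite_config w (config_of s).
Proof.
  intros Hw Hstates.
  apply (finite_config_of_box w (config_of s) (width (tab s)) (length (tab s))).
  - intros p. now apply read_states_below.
  - intros x y. apply read_outside.
Qed.

(** * The vertical highway *)

Definition digits (s : String.string) : list nat :=
  map (fun c => (Ascii.nat_of_ascii c - 48)%nat) (String.list_ascii_of_string s).

Definition picture (rows : list String.string) : table := rev (map digits rows).

Definition drift_check (w : list letter) (R : Z * Z -> bool) (n : nat) (d : Z * Z)
    (s : tconfig) : bool :=
  match table_run w R n s with
  | Some (_, s') =>
      dockedb d (config_of s') (config_of s) &&
      shift_check R d (tab s) (tab s')
  | None => false
  end.

Lemma drift_check_spec w R n d s : (0 < n)%nat ->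
  drift_check w R n d s = true ->
  (forall p, R p = true -> R (addZ2 p d) = true) ->
  drifts w (config_of s) n d.
Proof.
  intros Hn Hcheck HR. unfold drift_check in Hcheck.
  destruct (table_run w R n s) as [[tr s']|] eqn:Hrun; [|discriminate].
  apply andb_true_iff in Hcheck. destruct Hcheck as [Hmoved Hshift]. apply dockedb_docked in Hmoved.
  rewrite <- (table_run_length Hrun).
  destruct (table_run_sound R (config_of s) (0, 0) Hrun) as (C' & Hruns & Hdock & Hcells);
    auto using docked_config_of, cells_agree_config_of.
  apply drifts_of_run with C' R; auto.
  - eapply runs_weaken; [|exact Hruns]. intros p (q & Hq & ->). now rewrite addZ2_0_r.
  - intros ->. apply table_run_length in Hrun. cbn in Hrun. lia.
  - exact (docked_trans Hdock Hmoved).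
  - intros p Hp. rewrite <- (addZ2_0_r (addZ2 p d)), Hcells by auto.
    now apply (shift_check_spec R).
Qed.

Definition table_vertical : table :=
  picture ([
    "205552255554151";
    "153330044442531";
    "130002432220210";
    "012444423553100";
    "001111111111000";
    "000000000000000";
    "000000000000000" ])%string.

Definition start_vertical : tconfig := TConfig table_vertical (10, 6) DS.

Lemma vertical_drifts : drifts w_LLRRRL (config_of start_vertical) 300 (0, -2).
Proof.
  apply (drift_check_spec _ (fun p => snd p <=? 6)); [lia|vm_compute; reflexivity|].
  intros p. unfold addZ2. cbn [fst snd]. lia.
Qed.

Lemma vertical_highway : exists (C : ant_config) (n : nat) (a b : Z),
  is_highway w_LLRRRL C n a b /\ ~ diagonal_drift a b.
Proof.
  destruct (drifts_highway w_LLRRRL (config_of start_vertical) 300 (0, -2))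
    as (m & a & b & Hhighway & Hspeed).
  - apply config_of_finite; vm_compute; [lia|reflexivity].
  - lia.
  - apply vertical_drifts.
  - discriminate.
  - exists (config_of start_vertical), m, a, b. split; [assumption|].
    pose proof (proj1 (proj2 Hhighway)). unfold diagonal_drift. z2_lia.
Qed.

(** * Sweeping through copies of a block *)

Lemma concat_repeat_succ {A : Type} (l : list A) n :
  concat (repeat l (S n)) = concat (repeat l n) ++ l.
Proof. cbn [repeat]. now rewrite repeat_cons, concat_app, concat_cons, app_nil_r. Qed.

Lemma length_concat_repeat {A : Type} (l : list A) n :
  length (concat (repeat l n)) = (n * length l)%nat.
Proof. induction n as [|n IH]; cbn; [reflexivity|]. now rewrite length_app, IH. Qed.

Definition swept_block (W B : Z * Z -> bool) (u p : Z * Z) : bool :=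
  (W p || B p) && negb (W (addZ2 p (scaleZ2 (-1) u))).

(* One pass turns a window [W] followed by a block [B] into a swept block followed by the
   same window, displaced by [u]. *)
Section Sweep.

Variables (w : list letter) (Q W B : Z * Z -> bool) (u t0 : Z * Z).
Variables (n : nat) (s s' : tconfig) (tr : list nat).
Hypothesis pass : table_run w Q n s = Some (tr, s').
Hypothesis pass_docks : docked u (config_of s') (config_of s).
Hypothesis pass_inside : forall p, Q p = true -> W p || B p = true.
Hypothesis window_moves : forall p, W p = true ->
  W (addZ2 p u) || B (addZ2 p u) = true /\ read (tab s') (addZ2 p u) = read (tab s) p.
Hypothesis blocks_ahead_apart : forall p j,
  1 <= j -> B p = true -> Q (addZ2 p (scaleZ2 j u)) = false.
Hypothesis blocks_behind_apart : forall p j,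
  1 <= j -> swept_block W B u p = true -> Q (addZ2 p (scaleZ2 (- j) u)) = false.

Let stop : nat -> Z * Z := nth_shift t0 u.

Definition sweeping (i K : nat) (C : ant_config) : Prop :=
  docked (stop i) C (config_of s) /\
  cells_agree W (stop i) (cells C) (read (tab s)) /\
  (forall j, (i <= j < K)%nat -> cells_agree B (stop j) (cells C) (read (tab s))) /\
  (forall j, (j < i)%nat -> cells_agree (swept_block W B u) (stop j) (cells C) (read (tab s'))).

Lemma placed_stop_apart p i j :
  Q (addZ2 p (scaleZ2 (Z.of_nat j - Z.of_nat i) u)) = false ->
  ~ placed Q (stop i) (addZ2 p (stop j)).
Proof.
  intros HQ. replace (addZ2 p (stop j))
    with (addZ2 (addZ2 p (scaleZ2 (Z.of_nat j - Z.of_nat i) u)) (stop i))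
    by (unfold stop; z2_lia).
  now apply not_placed.
Qed.

Lemma sweep_step i K C : (i < K)%nat -> sweeping i K C ->
  exists C', runs w (placed Q (stop i)) C tr C' /\ sweeping (S i) K C'.
Proof.
  intros Hi (Hdock & HW & HB & Hswept).
  assert (HWB : cells_agree (fun p => W p || B p) (stop i) (cells C) (read (tab s))).
  { intros p Hp. apply orb_true_iff in Hp. destruct Hp as [Hp|Hp]; [now apply HW|].
    apply HB; [lia|assumption]. }
  destruct (table_run_sound _ _ _ pass pass_inside Hdock HWB) as (C' & Hrun & Hdock' & Hcells).
  assert (Hstop : stop (S i) = addZ2 u (stop i)) by (unfold stop; z2_lia).
  exists C'. split; [assumption|]. split; [|split; [|split]].
  - destruct Hdock' as [Hpos Hhead], pass_docks as [Hpos' Hhead'].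
    split; [rewrite Hstop; z2_lia|congruence].
  - intros p Hp. destruct (window_moves p Hp) as [Hin Hread].
    replace (addZ2 p (stop (S i))) with (addZ2 (addZ2 p u) (stop i)) by (rewrite Hstop; z2_lia).
    now rewrite Hcells.
  - intros j Hj. apply (cells_agree_unvisited B _ _ Hrun); [|apply HB; lia].
    intros p Hp. apply placed_stop_apart, blocks_ahead_apart; [lia|assumption].
  - intros j Hj. destruct (Nat.eq_dec j i) as [->|Hne].
    + intros p Hp. apply Hcells. now apply andb_true_iff in Hp.
    + apply (cells_agree_unvisited _ _ _ Hrun); [|apply Hswept; lia].
      intros p Hp. apply placed_stop_apart.
      replace (Z.of_nat j - Z.of_nat i) with (- (Z.of_nat i - Z.of_nat j)) by ring.
      apply blocks_behind_apart; [lia|assumption].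
Qed.

Lemma sweep K C : sweeping 0 K C ->
  exists C', runs w (fun p => exists i, (i < K)%nat /\ placed Q (stop i) p)
                  C (concat (repeat tr K)) C' /\
    sweeping K K C'.
Proof.
  intros Hstart.
  assert (Hprefix : forall i, (i <= K)%nat ->
    exists C', runs w (fun p => exists j, (j < i)%nat /\ placed Q (stop j) p)
                    C (concat (repeat tr i)) C' /\
      sweeping i K C'); [|now apply Hprefix].
  induction i as [|i IH]; intros Hi; [exists C; split; [apply runs_nil|assumption]|].
  destruct IH as (C1 & Hrun1 & Hinv1); [lia|].
  destruct (sweep_step i K C1 Hi Hinv1) as (C2 & Hrun2 & Hinv2).
  exists C2. split; [|assumption]. rewrite concat_repeat_succ. eapply runs_app.
  - eapply runs_weaken; [|exact Hrun1]. intros p (j & Hj & Hp). exists j. split; [lia|assumption].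
  - eapply runs_weaken; [|exact Hrun2]. intros p Hp. exists i. split; [lia|assumption].
Qed.

End Sweep.

(** * Diagonal highways of arbitrary width *)

Inductive strip_end : Type := West | East.

Definition opposite (z : strip_end) : strip_end := match z with West => East | East => West end.

(* Abscissa in the direction that leads from the end [z] into the strip. *)
Definition along (z : strip_end) (p : Z * Z) : Z :=
  match z with West => fst p | East => - fst p end.

Definition stride (z : strip_end) : Z * Z := match z with West => (2, 0) | East => (-2, 0) end.

Definition widening (K : nat) : Z := 2 * (Z.of_nat K - 1).

Definition anchor (K : nat) (z : strip_end) : Z * Z :=
  match z with West => (0, 0) | East => (widening K, 0) end.

Definition outer (z : strip_end) (e : Z) (p : Z * Z) : bool := along z p <? e.

Definition block (z : strip_end) (e : Z) (p : Z * Z) : bool :=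
  (e <=? along z p) && (along z p <? e + 2).

Definition window (z : strip_end) (e v : Z) (p : Z * Z) : bool :=
  (e - v <=? along z p) && (along z p <? e).

(* The block occupies the abscissas [e] and [e + 1] seen from [z], hence [-1 - e] and [- e]
   seen from the opposite end. *)
Definition stretched (z : strip_end) (e : Z) (K : nat) (c : Z * Z -> nat) (tb : table) : Prop :=
  cells_agree (outer z e) (anchor K z) c (read tb) /\
  cells_agree (outer (opposite z) (-1 - e)) (anchor K (opposite z)) c (read tb) /\
  (forall j, (j < K)%nat ->
     cells_agree (block z e) (nth_shift (anchor K z) (stride z) j) c (read tb)).

Ltac strip_lia :=
  unfold swept_block, outer, block, window, along, anchor, widening, opposite, stride,
    nth_shift, addZ2, scaleZ2 in *;
  cbn [fst snd] in *; lia.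

Lemma stretched_opposite {z e K c tb} :
  stretched z e K c tb -> stretched (opposite z) (-1 - e) K c tb.
Proof.
  intros (Hnear & Hfar & Hblocks). split; [|split].
  - exact Hfar.
  - replace (opposite (opposite z)) with z by now destruct z.
    now replace (-1 - (-1 - e)) with e by ring.
  - intros j Hj p Hp.
    replace (nth_shift (anchor K (opposite z)) (stride (opposite z)) j)
      with (nth_shift (anchor K z) (stride z) (K - 1 - j))
      by (destruct z; apply Z2_eq_iff; split; strip_lia).
    apply Hblocks; [lia|]. destruct z; strip_lia.
Qed.

Lemma stretched_run_end {w z e K Q n s tr s' C} :
  stretched z e K (cells C) (tab s) -> docked (anchor K z) C (config_of s) ->
  table_run w Q n s = Some (tr, s') -> (forall p, Q p = true -> outer z e p = true) ->
  exists C', runs w (placed Q (anchor K z)) C tr C' /\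
    stretched z e K (cells C') (tab s') /\ docked (anchor K z) C' (config_of s').
Proof.
  intros (Hnear & Hfar & Hblocks) Hdock Hrun Hsub.
  destruct (table_run_sound _ _ _ Hrun Hsub Hdock Hnear) as (C' & Hruns & Hdock' & Hcells).
  assert (Hapart : forall D t,
      (forall p q, D p = true -> outer z e q = true ->
         p <> q /\ addZ2 p t <> addZ2 q (anchor K z)) ->
      forall p, D p = true -> Q p = false /\ ~ placed Q (anchor K z) (addZ2 p t)).
  { intros D t HD p Hp. split.
    - apply not_true_is_false. intros HQ. now destruct (HD p p Hp (Hsub _ HQ)).
    - intros (q & Hq & Heq). now destruct (HD p q Hp (Hsub _ Hq)). }
  exists C'. split; [assumption|split; [split; [assumption|split]|assumption]].
  - apply (cells_agree_elsewhere _ _ Hrun Hruns); [|assumption].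
    apply Hapart. intros p q Hp Hq. rewrite !Z2_eq_iff. destruct z; strip_lia.
  - intros j Hj. apply (cells_agree_elsewhere _ _ Hrun Hruns); [|now apply Hblocks].
    apply Hapart. intros p q Hp Hq. rewrite !Z2_eq_iff. destruct z; strip_lia.
Qed.

Lemma sweeping_of_stretched {z e K s C} v s' :
  stretched z e K (cells C) (tab s) -> docked (anchor K z) C (config_of s) ->
  sweeping (window z e v) (block z e) (stride z) (anchor K z) s s' 0 K C.
Proof.
  intros (Hnear & _ & Hblocks) Hdock.
  assert (Hanchor : nth_shift (anchor K z) (stride z) 0 = anchor K z) by z2_lia.
  split; [now rewrite Hanchor|split; [|split]].
  - rewrite Hanchor. intros p Hp. apply Hnear. strip_lia.
  - intros j [_ Hj]. now apply Hblocks.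
  - intros j Hj. lia.
Qed.

Lemma outer_extended_by_window z e v K c tb tb' :
  cells_agree (outer (opposite z) (-1 - e)) (anchor K (opposite z)) c (read tb') ->
  cells_agree (window z e v) (nth_shift (anchor K z) (stride z) K) c (read tb) ->
  (forall p, window z e v p = true -> read tb' (addZ2 p (stride z)) = read tb p) ->
  cells_agree (outer (opposite z) (-1 - (e - v))) (anchor K (opposite z)) c (read tb').
Proof.
  intros Houter Hwindow Hmoved p Hp.
  destruct (Z_lt_ge_dec (along z p) (e + 2)) as [Hlt|Hge];
    [|apply Houter; destruct z; strip_lia].
  set (q := addZ2 p (scaleZ2 (-1) (stride z))).
  assert (Hq : window z e v q = true) by (unfold q; destruct z; strip_lia).
  replace p with (addZ2 q (stride z)) at 2 by (unfold q; z2_lia).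
  rewrite Hmoved, <- Hwindow by assumption. f_equal.
  unfold q. destruct z; apply Z2_eq_iff; strip_lia.
Qed.

Lemma stretched_sweep {w z e K Q n s tr s' C} v : (1 <= K)%nat -> 0 <= v ->
  stretched z e K (cells C) (tab s) -> docked (anchor K z) C (config_of s) ->
  table_run w Q n s = Some (tr, s') ->
  (forall p, Q p = true -> window z e v p || block z e p = true) ->
  docked (stride z) (config_of s') (config_of s) ->
  (forall p, window z e v p = true -> read (tab s') (addZ2 p (stride z)) = read (tab s) p) ->
  exists C',
    runs w (fun p => exists i, (i < K)%nat /\
              placed Q (nth_shift (anchor K z) (stride z) i) p)
         C (concat (repeat tr K)) C' /\
    stretched z (e - v) K (cells C') (tab s') /\
    docked (anchor K (opposite z)) C' (config_of s').
Proof.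
  intros HK Hv Hstretched Hdock Hrun Hsub Hmoved Hwindow.
  pose proof (sweeping_of_stretched v s' Hstretched Hdock) as Hstart.
  apply (sweep w Q _ _ _ _ n s s' tr Hrun Hmoved Hsub) in Hstart;
    [|intros p Hp; split; [|now apply Hwindow]; destruct z; strip_lia
     |intros p j Hj Hp; apply (outside_larger _ _ _ Hsub); destruct z; strip_lia
     |intros p j Hj Hp; apply (outside_larger _ _ _ Hsub); destruct z; strip_lia].
  destruct Hstart as (C' & Hruns & [Hpos Hhead] & HW & _ & Hswept).
  destruct Hstretched as (Hnear & Hfar & _).
  exists C'. split; [assumption|split; [split; [|split]|]].
  - apply (cells_agree_elsewhere _ _ Hrun Hruns); [|intros p Hp; apply Hnear; strip_lia].
    intros p Hp. split; [apply (outside_larger _ _ _ Hsub); strip_lia|].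
    intros (i & Hi & q & Hq & Heq). apply Hsub in Hq. apply Z2_eq_iff in Heq. destruct z; strip_lia.
  - apply outer_extended_by_window with (tab s); [|exact HW|exact Hwindow].
    apply (cells_agree_elsewhere _ _ Hrun Hruns); [|assumption].
    intros p Hp. split; [apply (outside_larger _ _ _ Hsub); destruct z; strip_lia|].
    intros (i & Hi & q & Hq & Heq). apply Hsub in Hq. apply Z2_eq_iff in Heq. destruct z; strip_lia.
  - intros j Hj p Hp. apply Hswept; [assumption|]. destruct z; strip_lia.
  - destruct Hmoved as [Hpos' Hhead']. split; [|congruence].
    rewrite Hpos, Hpos'. destruct z; apply Z2_eq_iff; strip_lia.
Qed.

(* Maps the plane onto the table whose block [e, e + 1] has been repeated [K] times. *)
Definition fold (e : Z) (K : nat) (p : Z * Z) : Z * Z :=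
  (if fst p <? e then fst p
   else if fst p <? e + 2 * Z.of_nat K then e + (fst p - e) mod 2
   else fst p - widening K, snd p).

Lemma fold_add e K p d : fold (e + fst d) K (addZ2 p d) = addZ2 (fold e K p) d.
Proof.
  unfold fold, addZ2. cbn [fst snd]. f_equal.
  destruct (Z.ltb_spec (fst p) e), (Z.ltb_spec (fst p + fst d) (e + fst d)); try lia.
  destruct (Z.ltb_spec (fst p) (e + 2 * Z.of_nat K)),
    (Z.ltb_spec (fst p + fst d) (e + fst d + 2 * Z.of_nat K)); try lia.
  replace (fst p + fst d - (e + fst d)) with (fst p - e) by ring. ring.
Qed.

Lemma fold_west e K p : fst p < e -> fold e K p = p.
Proof.
  intros Hp. unfold fold. destruct (Z.ltb_spec (fst p) e); [|lia]. now destruct p.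
Qed.

Lemma fold_block e K j x y : e <= x < e + 2 -> (j < K)%nat ->
  fold e K (x + 2 * Z.of_nat j, y) = (x, y).
Proof.
  intros Hx Hj. unfold fold. cbn [fst snd].
  destruct (Z.ltb_spec (x + 2 * Z.of_nat j) e); [lia|].
  destruct (Z.ltb_spec (x + 2 * Z.of_nat j) (e + 2 * Z.of_nat K)); [|lia].
  replace (x + 2 * Z.of_nat j - e) with (x - e + Z.of_nat j * 2) by ring.
  rewrite Z.mod_add, Z.mod_small by lia. f_equal. ring.
Qed.

Lemma fold_east e K x y : (1 <= K)%nat -> e + 2 <= x ->
  fold e K (x + widening K, y) = (x, y).
Proof.
  intros HK Hx. unfold fold, widening. cbn [fst snd].
  destruct (Z.ltb_spec (x + 2 * (Z.of_nat K - 1)) e); [lia|].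
  destruct (Z.ltb_spec (x + 2 * (Z.of_nat K - 1)) (e + 2 * Z.of_nat K)); [lia|].
  f_equal. ring.
Qed.

Lemma stretched_fold {e K c tb} : (1 <= K)%nat ->
  (stretched West e K c tb <-> forall p, c p = read tb (fold e K p)).
Proof.
  intros HK. split.
  - intros (Hwest & Heast & Hblocks) [x y].
    destruct (Z_lt_ge_dec x e); [|destruct (Z_lt_ge_dec x (e + 2 * Z.of_nat K))].
    + rewrite fold_west, <- Hwest by strip_lia. f_equal. apply Z2_eq_iff. strip_lia.
    + set (j := (x - e) / 2). set (q := (x - 2 * j, y)).
      pose proof (Z.div_mod (x - e) 2 ltac:(lia)).
      pose proof (Z.mod_pos_bound (x - e) 2 ltac:(lia)).
      replace (x, y) with (fst q + 2 * Z.of_nat (Z.to_nat j), snd q) at 2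
        by (unfold q; cbn [fst snd]; f_equal; lia).
      rewrite fold_block by (unfold q; cbn [fst]; lia).
      rewrite <- (Hblocks (Z.to_nat j)); [f_equal; apply Z2_eq_iff| |]; unfold q; strip_lia.
    + replace (x, y) with (x - widening K + widening K, y) at 2
        by (f_equal; ring).
      rewrite fold_east, <- Heast by strip_lia. f_equal. apply Z2_eq_iff. strip_lia.
  - intros Hc. split; [|split].
    + intros p Hp. rewrite Hc. change (anchor K West) with (0, 0).
      rewrite addZ2_0_r, fold_west; [reflexivity|strip_lia].
    + intros [x y] Hp. rewrite Hc.
      replace (addZ2 _ _) with (x + widening K, y) by (apply Z2_eq_iff; strip_lia).
      rewrite fold_east; [reflexivity|assumption|strip_lia].
    + intros j Hj [x y] Hp. rewrite Hc.
      replace (addZ2 _ _) with (x + 2 * Z.of_nat j, y) by (apply Z2_eq_iff; strip_lia).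
      rewrite fold_block; [reflexivity|strip_lia|assumption].
Qed.

(* The ant never returns to the cells outside these regions, where it leaves its trail. The
   constants fit [table_diagonal]. *)
Definition upper (p : Z * Z) : bool := (0 <=? fst p) && (10 <=? snd p).

Definition ahead (m : Z) (p : Z * Z) : bool :=
  upper p || ((1 <=? snd p) && (11 + m <=? fst p - snd p)).

Definition unspoiled (z : strip_end) : Z * Z -> bool :=
  match z with West => upper | East => ahead 0 end.

Lemma unspoiled_ahead K z p : (1 <= K)%nat -> unspoiled z p = true ->
  ahead (widening K) (addZ2 p (anchor K z)) = true.
Proof. intros HK Hp. destruct z; unfold unspoiled, ahead, upper in *; strip_lia. Qed.

Lemma upper_ahead K z i p : (i < K)%nat -> upper p = true ->
  ahead (widening K) (addZ2 p (nth_shift (anchor K z) (stride z) i)) = true.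
Proof. intros Hi Hp. destruct z; unfold ahead, upper in *; strip_lia. Qed.

Lemma ahead_fold e K p : 0 <= e <= 10 -> (1 <= K)%nat ->
  ahead (widening K) p = true -> ahead 0 (fold e K p) = true.
Proof.
  intros He HK Hp. unfold ahead, upper, fold, widening in *. cbn [fst snd].
  destruct (Z.ltb_spec (fst p) e); [lia|].
  pose proof (Z.mod_pos_bound (fst p - e) 2 ltac:(lia)).
  destruct (Z.ltb_spec (fst p) (e + 2 * Z.of_nat K)); lia.
Qed.

Lemma ahead_add_diagonal m k p : 0 <= k -> ahead m p = true -> ahead m (addZ2 p (k, k)) = true.
Proof. intros Hk Hp. unfold ahead, upper, addZ2 in *. cbn [fst snd]. lia. Qed.

Record pass : Type := Pass { end_steps : nat; block_steps : nat; window_width : Z }.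

Definition make_pass (w : list letter) (a : pass) (z : strip_end) (e : Z) (s : tconfig)
    : option tconfig :=
  let v := window_width a in
  match table_run w (fun p => outer z e p && unspoiled z p) (end_steps a) s with
  | None => None
  | Some (_, s1) =>
    match table_run w (fun p => (window z e v p || block z e p) && upper p) (block_steps a) s1 with
    | None => None
    | Some (_, s2) =>
        if (0 <=? v) && dockedb (stride z) (config_of s2) (config_of s1) &&
           shift_check (window z e v) (stride z) (tab s1) (tab s2)
        then Some s2 else None
    end
  end.

Fixpoint make_passes (w : list letter) (ops : list pass) (z : strip_end) (e : Z) (s : tconfig)
    : option (strip_end * Z * tconfig) :=
  match ops with
  | [] => Some (z, e, s)
  | a :: ops' =>
      match make_pass w a z e s with
      | Some s' => make_passes w ops' (opposite z) (-1 - (e - window_width a)) s'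
      | None => None
      end
  end.

Lemma stretched_run_unspoiled {w z e K n s tr s' C} : (1 <= K)%nat ->
  stretched z e K (cells C) (tab s) -> docked (anchor K z) C (config_of s) ->
  table_run w (fun p => outer z e p && unspoiled z p) n s = Some (tr, s') ->
  exists C', runs w (fun p => ahead (widening K) p = true) C tr C' /\
    stretched z e K (cells C') (tab s') /\ docked (anchor K z) C' (config_of s').
Proof.
  intros HK Hstretched Hdock Hrun.
  destruct (stretched_run_end Hstretched Hdock Hrun)
    as (C' & Hruns & Hend); [intros p Hp; now apply andb_true_iff in Hp|].
  exists C'. split; [|assumption].
  eapply runs_weaken; [|exact Hruns]. intros p (q & Hq & ->).
  apply andb_true_iff in Hq. now apply unspoiled_ahead.
Qed.

Lemma make_pass_sound {w a z e s s' K C} : (1 <= K)%nat ->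
  make_pass w a z e s = Some s' ->
  stretched z e K (cells C) (tab s) -> docked (anchor K z) C (config_of s) ->
  exists tr C', runs w (fun p => ahead (widening K) p = true) C tr C' /\
    length tr = (end_steps a + K * block_steps a)%nat /\
    stretched z (e - window_width a) K (cells C') (tab s') /\
    docked (anchor K (opposite z)) C' (config_of s').
Proof.
  intros HK Hpass Hstretched Hdock. unfold make_pass in Hpass.
  destruct (table_run _ _ (end_steps a) s) as [[tr1 s1]|] eqn:Hrun1; [|discriminate].
  destruct (table_run _ _ (block_steps a) s1) as [[tr2 s2]|] eqn:Hrun2; [|discriminate].
  destruct (_ && shift_check _ _ _ _) eqn:Hcheck; [|discriminate]. injection Hpass as <-.
  rewrite !andb_true_iff, Z.leb_le in Hcheck. destruct Hcheck as [[Hv Hmoved] Hshift].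
  apply dockedb_docked in Hmoved.
  destruct (stretched_run_unspoiled HK Hstretched Hdock Hrun1)
    as (C1 & Hruns1 & Hstretched1 & Hdock1).
  destruct (stretched_sweep (window_width a) HK Hv Hstretched1 Hdock1 Hrun2)
    as (C2 & Hruns2 & Hstretched2 & Hdock2); auto.
  { intros p Hp. now apply andb_true_iff in Hp. }
  { intros p. now apply shift_check_spec. }
  exists (tr1 ++ concat (repeat tr2 K)), C2. split; [|split; [|now split]].
  - eapply runs_app; [exact Hruns1|]. eapply runs_weaken; [|exact Hruns2].
    intros p (i & Hi & q & Hq & ->). apply andb_true_iff in Hq. now apply upper_ahead.
  - rewrite length_app, length_concat_repeat.
    now rewrite (table_run_length Hrun1), (table_run_length Hrun2).
Qed.

Definition passes_steps (K : nat) (ops : list pass) : nat :=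
  list_sum (map (fun a => (end_steps a + K * block_steps a)%nat) ops).

Lemma make_passes_sound {w K ops} : (1 <= K)%nat -> forall {z e s z' e' s' C},
  make_passes w ops z e s = Some (z', e', s') ->
  stretched z e K (cells C) (tab s) -> docked (anchor K z) C (config_of s) ->
  exists tr C', runs w (fun p => ahead (widening K) p = true) C tr C' /\
    length tr = passes_steps K ops /\
    stretched z' e' K (cells C') (tab s') /\ docked (anchor K z') C' (config_of s').
Proof.
  intros HK.
  induction ops as [|a ops IH]; cbn [make_passes]; intros z e s z' e' s' C Hops Hstr Hdock.
  - injection Hops as <- <- <-. exists [], C. split; [apply runs_nil|]. now split.
  - destruct (make_pass w a z e s) as [s1|] eqn:Hpass; [|discriminate].
    destruct (make_pass_sound HK Hpass Hstr Hdock) as (tr1 & C1 & Hruns1 & Hlen1 & Hstr1 & Hdock1).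
    destruct (IH _ _ _ _ _ _ _ Hops (stretched_opposite Hstr1) Hdock1)
      as (tr2 & C2 & Hruns2 & Hlen2 & Hend).
    exists (tr1 ++ tr2), C2. split; [eauto using runs_app|split; [|assumption]].
    rewrite length_app, Hlen1, Hlen2. reflexivity.
Qed.

Definition wide (e : Z) (K : nat) (s : tconfig) : ant_config :=
  mkConfig (fun p => read (tab s) (fold e K p)) (addZ2 (tpos s) (anchor K East)) (thead s).

(* The passes move the block by [k] columns, and [r] further steps at the east end complete
   the period. *)
Definition period_check (w : list letter) (ops : list pass) (r : nat) (e k : Z) (s0 : tconfig)
    : bool :=
  match make_passes w ops East (-1 - e) s0 with
  | Some (East, e', s) =>
    match table_run w (fun p => outer East e' p && unspoiled East p) r s with
    | Some (_, s') =>
        dockedb (k, k) (config_of s') (config_of s0) &&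
        (e' =? -1 - (e + k)) && shift_check (ahead 0) (k, k) (tab s0) (tab s')
    | None => false
    end
  | _ => false
  end.

Lemma wide_drifts w ops r e k s0 K : (1 <= K)%nat -> 0 <= e <= 10 -> 0 <= k -> (0 < r)%nat ->
  period_check w ops r e k s0 = true ->
  drifts w (wide e K s0) (passes_steps K ops + r) (k, k).
Proof.
  intros HK He Hk Hr Hcheck. unfold period_check in Hcheck.
  destruct (make_passes _ _ _ _ _) as [[[[] e'] s]|] eqn:Hops; try discriminate Hcheck.
  destruct (table_run _ _ _ _) as [[tr s']|] eqn:Hrun; [|discriminate Hcheck].
  rewrite !andb_true_iff, Z.eqb_eq in Hcheck. destruct Hcheck as [[Hmoved ->] Hshift].
  apply dockedb_docked in Hmoved.
  assert (Hstart : stretched East (-1 - e) K (cells (wide e K s0)) (tab s0))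
    by (now apply (@stretched_opposite West), stretched_fold).
  destruct (make_passes_sound HK Hops Hstart)
    as (tr1 & C1 & Hruns1 & Hlen1 & Hstr1 & Hdock1); [now split|].
  destruct (stretched_run_unspoiled HK Hstr1 Hdock1 Hrun) as (C2 & Hruns2 & Hstr2 & Hdock2).
  rewrite <- Hlen1, <- (table_run_length Hrun), <- length_app.
  apply drifts_of_run with C2 (ahead (widening K)).
  - eauto using runs_app.
  - intros Hnil. apply app_eq_nil in Hnil. destruct Hnil as [_ ->].
    apply table_run_length in Hrun. cbn in Hrun. lia.
  - intros p. now apply ahead_add_diagonal.
  - destruct Hdock2 as [Hpos Hhead], Hmoved as [Hpos' Hhead'].
    split; [|cbn in *; congruence]. cbn [pos wide config_of] in *. z2_lia.
  - apply stretched_opposite in Hstr2.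
    replace (-1 - (-1 - (e + k))) with (e + fst (k, k)) in Hstr2 by (cbn [fst]; ring).
    intros p Hp. rewrite (proj1 (stretched_fold HK) Hstr2), fold_add.
    apply (shift_check_spec (ahead 0)); [assumption|now apply ahead_fold].
Qed.

Lemma wide_finite w e K s : 0 <= e -> (0 < length w)%nat ->
  states_below (length w) (tab s) = true -> finite_config w (wide e K s).
Proof.
  intros He Hw Hstates.
  apply (finite_config_of_box w _ (Z.to_nat e + width (tab s) + 2 * K) (length (tab s))).
  - intros p. now apply read_states_below.
  - intros x y Hout. cbn [wide cells]. unfold fold, widening. cbn [fst snd]. apply read_outside.
    destruct (Z.ltb_spec x e); [lia|]. destruct (Z.ltb_spec x (e + 2 * Z.of_nat K)); lia.
Qed.

Definition table_diagonal : table :=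
  picture ([
    "000000000000000000000000000000";
    "000000000000000000000000000000";
    "000000000000000000000000000000";
    "000000000000000000000000000000";
    "000000000000000000000011110000";
    "011222222222222221111124410000";
    "135000000000000004444441020000";
    "424444444444444432222232520000";
    "300000000000001544444542300000";
    "000000000000010555555420300000";
    "000000000000000000005200300000";
    "000000000000000000050400300000";
    "000000000000000000010414200000";
    "000000000000000002021102000000";
    "000000000000000013242202000000";
    "000000000000000134550202000000";
    "000000000000002043204151000000";
    "000000000000022101450531000000";
    "000000000000253101442110000000";
    "000000000000000000000000000000" ])%string.

Definition start_diagonal : tconfig := TConfig table_diagonal (17, 5) DS.

Definition passes_diagonal : list pass :=
  [ Pass 229 4 6; Pass 14 4 6; Pass 42 4 6; Pass 26 4 4; Pass 238 28 4; Pass 70 4 4;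
    Pass 206 4 4; Pass 10 4 4; Pass 46 4 4; Pass 22 4 2; Pass 286 28 2; Pass 42 4 2 ].

Lemma wide_diagonal_drifts K : (1 <= K)%nat ->
  drifts w_LLRRRL (wide 3 K start_diagonal) (1472 + K * 96) (4, 4).
Proof.
  intros HK. replace (1472 + K * 96)%nat with (passes_steps K passes_diagonal + 241)%nat
    by (cbn [passes_steps passes_diagonal map list_sum fold_right end_steps block_steps]; lia).
  apply wide_drifts; [assumption|lia|lia|lia|vm_compute; reflexivity].
Qed.

Lemma diagonal_highways : exists H : nat -> ant_config,
  (forall i, exists (n : nat) (a b : Z),
     is_highway w_LLRRRL (H i) n a b /\ diagonal_drift a b) /\
  (forall i j, i <> j -> ~ highway_equiv w_LLRRRL (H i) (H j)).
Proof.
  exists (fun i => wide 3 (S i) start_diagonal). split.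
  - intros i.
    destruct (drifts_highway w_LLRRRL (wide 3 (S i) start_diagonal) (1472 + S i * 96) (4, 4))
      as (m & a & b & Hhighway & Hspeed).
    + apply wide_finite; [lia|cbn; lia|vm_compute; reflexivity].
    + lia.
    + apply wide_diagonal_drifts. lia.
    + discriminate.
    + exists m, a, b. split; [assumption|]. left.
      apply Z2_eq_iff in Hspeed. cbn [fst snd scaleZ2] in Hspeed. nia.
  - intros i j Hij Hequiv.
    assert (1472 + S i * 96 = 1472 + S j * 96)%nat; [|lia].
    eapply highway_equiv_period;
      [apply wide_diagonal_drifts; lia|apply wide_diagonal_drifts; lia|discriminate|exact Hequiv].
Qed.

(** * Interlaced traces *)

Lemma interlace_prefix_succ uv N :
  interlace_prefix uv (S N) = interlace_prefix uv N ++ interlace_block uv N.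
Proof.
  unfold interlace_prefix. rewrite seq_S, map_app, concat_app. cbn. now rewrite app_nil_r.
Qed.

Definition cycle_start (uv : list (list nat * list nat)) (n : nat) : nat :=
  length (interlace_prefix uv n).

Lemma cycle_start_succ uv n :
  cycle_start uv (S n) = (cycle_start uv n + length (interlace_block uv n))%nat.
Proof. unfold cycle_start. now rewrite interlace_prefix_succ, length_app. Qed.

Section Cycles.

Variables (w : list letter) (uv : list (list nat * list nat)).
Variables (Inv : nat -> ant_config -> Prop) (V : nat -> Z * Z -> Prop) (C0 : ant_config).
Hypothesis initial : Inv 0 C0.
Hypothesis cycle : forall n C, Inv n C ->
  exists C', runs w (V n) C (interlace_block uv n) C' /\ Inv (S n) C'.

Lemma cycles_prefix n : exists C,
  runs w (fun _ => True) C0 (interlace_prefix uv n) C /\ Inv n C.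
Proof.
  induction n as [|n (C & Hrun & HC)]; [exists C0; split; [apply runs_nil|assumption]|].
  destruct (cycle n C HC) as (C' & Hrun' & HC'). exists C'. split; [|assumption].
  rewrite interlace_prefix_succ. eapply runs_app; [exact Hrun|].
  now apply runs_weaken with (2 := Hrun').
Qed.

Lemma cycle_start_inv n : Inv n (ant_iter w (cycle_start uv n) C0).
Proof.
  destruct (cycles_prefix n) as (C & Hrun & HC). unfold cycle_start. now rewrite (runs_end Hrun).
Qed.

Lemma cycles_trajectory n i : (i < length (interlace_block uv n))%nat ->
  V n (trajectory w C0 (cycle_start uv n + i)).
Proof.
  intros Hi. destruct (cycle n _ (cycle_start_inv n)) as (C' & Hrun & _).
  rewrite trajectory_add. exact (runs_trajectory _ Hrun Hi).
Qed.

Lemma cycles_interlaced : (forall n, (cycle_start uv n < cycle_start uv (S n))%nat) ->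
  interlaced (trace w C0).
Proof.
  intros Hinc. exists uv. split; [|split].
  - intros ->. specialize (Hinc 0%nat). cbn in Hinc. lia.
  - intros N i Hi. destruct (cycles_prefix N) as (C & Hrun & _). exact (runs_trace _ Hrun Hi).
  - intros M. exists M. change (M <= cycle_start uv M)%nat.
    induction M as [|M IH]; [lia|]. specialize (Hinc M). lia.
Qed.

End Cycles.

(** * Stages of an increasing sequence of times *)

Section Stages.

Variable start : nat -> nat.
Hypothesis start_0 : start 0 = 0%nat.
Hypothesis start_lt : forall n, (start n < start (S n))%nat.

Fixpoint stage (t : nat) : nat :=
  match t with
  | 0%nat => 0%nat
  | S t' => if (start (S (stage t')) <=? S t')%nat then S (stage t') else stage t'
  end.

Lemma start_le m n : (m <= n)%nat -> (start m + (n - m) <= start n)%nat.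
Proof. induction 1 as [|n Hmn IH]; [lia|]. specialize (start_lt n). lia. Qed.

Lemma stage_spec t : (start (stage t) <= t < start (S (stage t)))%nat.
Proof.
  induction t as [|t IH]; cbn [stage]; [specialize (start_lt 0); lia|].
  destruct (Nat.leb_spec (start (S (stage t))) (S t)); [|lia].
  specialize (start_lt (S (stage t))). lia.
Qed.

Lemma stage_le m n : (m <= n)%nat -> (stage m <= stage n)%nat.
Proof. induction 1 as [|n Hmn IH]; [lia|]. cbn [stage]. destruct (_ <=? _)%nat; lia. Qed.

Lemma stage_unique n t : (start n <= t < start (S n))%nat -> stage t = n.
Proof.
  intros Ht. pose proof (stage_spec t) as Hspec. set (m := stage t) in *.
  destruct (Nat.lt_trichotomy m n) as [Hlt|[Heq|Hgt]]; [|assumption|].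
  - pose proof (start_le (S m) n Hlt). lia.
  - pose proof (start_le (S n) m Hgt). lia.
Qed.

Lemma stage_tends_to_infty : tends_to_infty (fun t => INR (stage t)).
Proof.
  intros M. destruct (INR_unbounded M) as [n Hn]. exists (start n). intros t Ht.
  apply Rle_trans with (INR n); [apply Rlt_le, Hn|]. apply le_INR.
  pose proof (stage_spec t). destruct (Nat.le_gt_cases n (stage t)) as [|Hlt]; [assumption|].
  pose proof (start_le (S (stage t)) n Hlt). lia.
Qed.

Lemma previsible_of_stages Delta y k d : d <> (0, 0)%R ->
  (forall n t, (start n <= t < start (S n))%nat ->
     near_boundary (IZR k) (dil_trans (INR n) 0 d Delta) (toR2 (y t))) ->
  (forall p n, boundary Delta p -> exists t, (start n <= t < start (S n))%nat /\
     (dist2 (toR2 (y t)) (INR n * fst p, INR n * snd p) <= IZR k)%R) ->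
  previsible_with Delta y (fun t => INR (stage t)) (fun _ => 0%R) k d.
Proof.
  intros Hd Hnear Hdense. repeat split; auto.
  - intros t. apply pos_INR.
  - intros t. apply Rle_refl.
  - intros m n Hmn. apply le_INR, stage_le, Hmn.
  - intros m n _. apply Rle_refl.
  - intros t. apply Hnear, stage_spec.
  - intros p Hp N. destruct (Hdense p N Hp) as (t & Ht & Hdist). exists t. split.
    + pose proof (start_le 0 N ltac:(lia)). lia.
    + rewrite (stage_unique N t Ht), !Rmult_0_l, !Rplus_0_r. exact Hdist.
Qed.

End Stages.

(** * The growing square *)

(* The frame around the square consists of four corners and of four sides made of copies of a
   block of width 2. [Side q] is the side on the side [q] of the square, and [Corner q] the
   corner from which the ant, walking counterclockwise, enters it. *)
Inductive chart : Type := Corner (q : dir) | Side (q : dir).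

Lemma chart_eq_dec (c c' : chart) : {c = c'} + {c <> c'}.
Proof. repeat decide equality. Qed.

Definition next (c : chart) : chart :=
  match c with Corner q => Side q | Side q => Corner (rot_ccw q) end.

(* The constants fit [table_square]. *)
Definition dom (c : chart) (p : Z * Z) : bool :=
  let '(x, y) := p in
  match c with
  | Corner DS => (x <? 41) && (y <? 24)
  | Side DS => (41 <=? x) && (x <? 43) && (y <? 24)
  | Corner DE => (43 <=? x) && (y <? 24)
  | Side DE => (61 <=? x) && (24 <=? y) && (y <? 26)
  | Corner DN => (43 <=? x) && (26 <=? y)
  | Side DN => (41 <=? x) && (x <? 43) && (26 <=? y)
  | Corner DW => (x <? 41) && (26 <=? y)
  | Side DW => (x <? 12) && (24 <=? y) && (y <? 26)
  end.

(* Displacement of the chart, away from the centre, when the square grows. *)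
Definition push (c : chart) : Z * Z :=
  match c with
  | Corner q => scaleZ2 2 (addZ2 (dir_vec q) (dir_vec (rot_cw q)))
  | Side q => scaleZ2 2 (dir_vec q)
  end.

Definition block_shift (c : chart) : Z * Z :=
  match c with Corner _ => (0, 0) | Side q => scaleZ2 2 (dir_vec (rot_ccw q)) end.

Definition base (n : nat) (c : chart) : Z * Z :=
  match c with Corner q | Side q => scaleZ2 (Z.of_nat n) (push (Corner q)) end.

Definition offset (n : nat) (c : chart) (j : nat) : Z * Z :=
  nth_shift (base n c) (block_shift c) j.

Definition copies (n : nat) (c : chart) : nat :=
  match c with Corner _ => 1%nat | Side _ => S (2 * n) end.

Definition covers (n : nat) (C : ant_config) (tb : table) : Prop :=
  forall c j, (j < copies n c)%nat -> cells_agree (dom c) (offset n c j) (cells C) (read tb).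

Ltac chart_lia :=
  unfold offset, base, push, block_shift, copies, dom, dir_vec, rot_cw, rot_ccw,
    nth_shift, addZ2, scaleZ2 in *;
  cbn [fst snd] in *; lia.

Lemma offset_0 n c : offset n c 0 = base n c.
Proof. unfold offset. z2_lia. Qed.

Lemma offset_last n c : offset n c (copies n c - 1) = base n (next c).
Proof. destruct c as [q|[]]; apply Z2_eq_iff; unfold next; chart_lia. Qed.

Lemma charts_disjoint n c c' j j' p p' : (j < copies n c)%nat -> (j' < copies n c')%nat ->
  dom c p = true -> dom c' p' = true ->
  addZ2 p (offset n c j) = addZ2 p' (offset n c' j') -> c = c'.
Proof.
  destruct p as [x y], p' as [x' y']. intros Hj Hj' Hp Hp' Heq. apply Z2_eq_iff in Heq.
  destruct c as [[]|[]], c' as [[]|[]]; try reflexivity; exfalso; chart_lia.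
Qed.

Lemma dom_disjoint c c' p : dom c p = true -> dom c' p = true -> c = c'.
Proof.
  intros Hp Hp'. apply (charts_disjoint 0 c c' 0 0 p p); auto.
  - destruct c; cbn; lia.
  - destruct c'; cbn; lia.
  - rewrite !offset_0. now destruct c, c'.
Qed.

Definition inbox (p : Z * Z) : bool :=
  (0 <=? fst p) && (fst p <? 74) && (0 <=? snd p) && (snd p <? 44).

Definition region (c : chart) (p : Z * Z) : bool := dom c p && inbox p.

Definition near_copies (n : nat) (c : chart) (k : nat) (p : Z * Z) : Prop :=
  exists j, (j < k)%nat /\ placed (region c) (offset n c j) p.

Definition near_frame (n : nat) (p : Z * Z) : Prop := exists c, near_copies n c (copies n c) p.

Lemma region_dom c p : region c p = true -> dom c p = true.
Proof. intros Hp. now apply andb_true_iff in Hp. Qed.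

Lemma covers_update {w n c m s tr s' C trs C'} :
  covers n C (tab s) -> table_run w (region c) m s = Some (tr, s') ->
  runs w (near_copies n c (copies n c)) C trs C' ->
  (forall j, (j < copies n c)%nat ->
     cells_agree (dom c) (offset n c j) (cells C') (read (tab s'))) ->
  covers n C' (tab s').
Proof.
  intros Hcovers Hrun Hruns Hupdated c' j Hj.
  destruct (chart_eq_dec c' c) as [->|Hne]; [now apply Hupdated|].
  apply (cells_agree_elsewhere _ _ Hrun Hruns); [|now apply Hcovers].
  intros p Hp. split.
  - apply not_true_is_false. intros HQ. apply Hne. now apply dom_disjoint with p, region_dom.
  - intros (j' & Hj' & q & Hq & Heq). apply Hne.
    apply (charts_disjoint n c' c j j' p q); auto using region_dom.
Qed.

Lemma traverse_corner {w n q m s tr s' C} :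
  covers n C (tab s) -> docked (base n (Corner q)) C (config_of s) ->
  table_run w (region (Corner q)) m s = Some (tr, s') ->
  exists C', runs w (near_copies n (Corner q) 1) C tr C' /\
    covers n C' (tab s') /\ docked (base n (Corner q)) C' (config_of s').
Proof.
  intros Hcovers Hdock Hrun. rewrite <- offset_0 in Hdock |- *.
  destruct (table_run_sound (dom (Corner q)) _ _ Hrun (region_dom _) Hdock)
    as (C' & Hruns & Hdock' & Hcells); [apply Hcovers; cbn; lia|].
  assert (Hnear : runs w (near_copies n (Corner q) 1) C tr C').
  { eapply runs_weaken; [|exact Hruns]. intros p Hp. exists 0%nat. split; [lia|assumption]. }
  exists C'. split; [assumption|split; [|assumption]].
  apply (covers_update Hcovers Hrun Hnear).
  intros j Hj. cbn in Hj. now replace j with 0%nat by lia.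
Qed.

Lemma sweep_side {w n q m s tr s' C} k : (k <= copies n (Side q))%nat ->
  covers n C (tab s) -> docked (base n (Side q)) C (config_of s) ->
  table_run w (region (Side q)) m s = Some (tr, s') ->
  docked (block_shift (Side q)) (config_of s') (config_of s) ->
  exists C', runs w (near_copies n (Side q) k) C (concat (repeat tr k)) C' /\
    docked (offset n (Side q) k) C' (config_of s) /\
    forall j, (j < k)%nat ->
      cells_agree (dom (Side q)) (offset n (Side q) j) (cells C') (read (tab s')).
Proof.
  intros Hk Hcovers Hdock Hrun Hmoved.
  assert (Hstart : sweeping (fun _ => false) (dom (Side q)) (block_shift (Side q))
                     (base n (Side q)) s s' 0 k C).
  { split; [|split; [|split]].
    - change (docked (offset n (Side q) 0) C (config_of s)). now rewrite offset_0.
    - discriminate.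
    - intros j Hj. apply Hcovers. lia.
    - lia. }
  apply (sweep w (region (Side q)) _ _ _ _ m s s' tr Hrun Hmoved) in Hstart.
  - destruct Hstart as (C' & Hruns & Hdock' & _ & _ & Hswept).
    exists C'. split; [exact Hruns|split; [exact Hdock'|]].
    intros j Hj p Hp. apply Hswept; [assumption|]. unfold swept_block. now rewrite Hp.
  - apply region_dom.
  - discriminate.
  - intros [x y] j Hj Hp. apply (outside_larger _ _ _ (region_dom (Side q))).
    destruct q; chart_lia.
  - intros [x y] j Hj Hp. apply (outside_larger _ _ _ (region_dom (Side q))).
    apply andb_true_iff in Hp. destruct Hp as [Hp _]. destruct q; chart_lia.
Qed.

Lemma traverse_side {w n q m s tr s' C} :
  covers n C (tab s) -> docked (base n (Side q)) C (config_of s) ->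
  table_run w (region (Side q)) m s = Some (tr, s') ->
  docked (block_shift (Side q)) (config_of s') (config_of s) ->
  exists C', runs w (near_copies n (Side q) (copies n (Side q)))
                  C (concat (repeat tr (copies n (Side q)))) C' /\
    covers n C' (tab s') /\ docked (base n (next (Side q))) C' (config_of s').
Proof.
  intros Hcovers Hdock Hrun Hmoved.
  destruct (sweep_side _ (Nat.le_refl _) Hcovers Hdock Hrun Hmoved)
    as (C' & Hruns & [Hpos Hhead] & Hcells).
  exists C'. split; [assumption|split].
  - exact (covers_update Hcovers Hrun Hruns Hcells).
  - destruct Hmoved as [Hpos' Hhead']. split; [|congruence].
    rewrite Hpos, Hpos', <- offset_last. unfold offset. cbn [copies].
    replace (S (2 * n) - 1)%nat with (2 * n)%nat by lia. z2_lia.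
Qed.

Lemma traverse_side_visits {w n q m s tr s' C} j : (0 < m)%nat -> (j < copies n (Side q))%nat ->
  covers n C (tab s) -> docked (base n (Side q)) C (config_of s) ->
  table_run w (region (Side q)) m s = Some (tr, s') ->
  docked (block_shift (Side q)) (config_of s') (config_of s) ->
  exists i, (i < copies n (Side q) * m)%nat /\
    placed inbox (offset n (Side q) j) (trajectory w C i).
Proof.
  intros Hm Hj Hcovers Hdock Hrun Hmoved.
  destruct (sweep_side j (Nat.lt_le_incl _ _ Hj) Hcovers Hdock Hrun Hmoved)
    as (C' & Hruns & [Hpos _] & _).
  apply runs_end in Hruns. rewrite length_concat_repeat, (table_run_length Hrun) in Hruns.
  exists (j * m)%nat. split; [nia|]. exists (tpos s). split.
  - destruct m as [|m]; [lia|]. apply table_run_succ in Hrun. destruct Hrun as [Hin _].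
    now apply andb_true_iff in Hin.
  - unfold trajectory. rewrite Hruns. exact Hpos.
Qed.

Definition chart_words (c : chart) (tr : list nat) : list nat * list nat :=
  (tr, match c with Corner _ => [] | Side _ => tr ++ tr end).

Lemma chart_words_block c tr n :
  tr ++ concat (repeat (snd (chart_words c tr)) n) = concat (repeat tr (copies n c)).
Proof.
  destruct c as [q|q]; cbn [snd chart_words copies repeat concat]; f_equal.
  - now induction n.
  - induction n as [|n IH]; [reflexivity|].
    replace (2 * S n)%nat with (S (S (2 * n))) by lia. cbn [repeat concat].
    now rewrite IH, app_assoc.
Qed.

Definition traversal_check (c : chart) (m : nat) (s s' : tconfig) : bool :=
  match c with
  | Corner _ => true
  | Side _ => dockedb (block_shift c) (config_of s') (config_of s) && (0 <? m)%nat
  end.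

Definition visits_before (w : list letter) (C : ant_config) (l n : nat) (c : chart) : Prop :=
  forall j, (j < copies n c)%nat ->
    exists i, (i < l)%nat /\ placed inbox (offset n c j) (trajectory w C i).

Lemma traverse {w n c m s tr s' C} : traversal_check c m s s' = true ->
  covers n C (tab s) -> docked (base n c) C (config_of s) ->
  table_run w (region c) m s = Some (tr, s') ->
  exists C', runs w (near_frame n) C (concat (repeat tr (copies n c))) C' /\
    covers n C' (tab s') /\ docked (base n (next c)) C' (config_of s') /\
    forall q, c = Side q -> visits_before w C (length (concat (repeat tr (copies n c)))) n c.
Proof.
  intros Hcheck Hcovers Hdock Hrun. destruct c as [q|q]; cbn [traversal_check] in Hcheck.
  - destruct (traverse_corner Hcovers Hdock Hrun)
      as (C' & Hruns & Hcovers' & Hdock').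
    exists C'. cbn [copies repeat concat]. rewrite app_nil_r.
    split; [|split; [assumption|split; [assumption|discriminate]]].
    eapply runs_weaken; [|exact Hruns]. intros p Hp. now exists (Corner q).
  - rewrite andb_true_iff, Nat.ltb_lt in Hcheck. destruct Hcheck as [Hmoved Hsteps].
    apply dockedb_docked in Hmoved.
    destruct (traverse_side Hcovers Hdock Hrun Hmoved) as (C' & Hruns & Hcovers' & Hdock').
    exists C'. split; [|split; [assumption|split; [assumption|]]].
    + eapply runs_weaken; [|exact Hruns]. intros p Hp. now exists (Side q).
    + intros _ _ j Hj. rewrite length_concat_repeat, (table_run_length Hrun).
      exact (traverse_side_visits j Hsteps Hj Hcovers Hdock Hrun Hmoved).
Qed.

Fixpoint tour (w : list letter) (ms : list nat) (c : chart) (s : tconfig)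
    : option (list (list nat * list nat) * chart * tconfig) :=
  match ms with
  | [] => Some ([], c, s)
  | m :: ms' =>
    match table_run w (region c) m s with
    | None => None
    | Some (tr, s') =>
      if traversal_check c m s s' then
        match tour w ms' (next c) s' with
        | Some (uv, c', s'') => Some (chart_words c tr :: uv, c', s'')
        | None => None
        end
      else None
    end
  end.

Fixpoint itinerary (c : chart) (k : nat) : list chart :=
  match k with 0%nat => [] | S k' => c :: itinerary (next c) k' end.

Lemma visits_before_app w n C l C1 l1 c : ant_iter w l C = C1 ->
  visits_before w C1 l1 n c -> visits_before w C (l + l1) n c.
Proof.
  intros <- Hvisits j Hj. destruct (Hvisits j Hj) as (i & Hi & Hp).
  exists (l + i)%nat. rewrite trajectory_add. split; [lia|assumption].
Qed.

Lemma visits_before_le w n C l l' c : (l <= l')%nat ->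
  visits_before w C l n c -> visits_before w C l' n c.
Proof.
  intros Hl Hvisits j Hj. destruct (Hvisits j Hj) as (i & Hi & Hp).
  exists i. split; [lia|assumption].
Qed.

Lemma tour_sound {w n ms} : forall {c s uv c' s' C},
  tour w ms c s = Some (uv, c', s') ->
  covers n C (tab s) -> docked (base n c) C (config_of s) ->
  exists C', runs w (near_frame n) C (interlace_block uv n) C' /\
    covers n C' (tab s') /\ docked (base n c') C' (config_of s') /\
    forall q, In (Side q) (itinerary c (length ms)) ->
      visits_before w C (length (interlace_block uv n)) n (Side q).
Proof.
  induction ms as [|m ms IH]; cbn [tour]; intros c s uv c' s' C Htour Hcovers Hdock.
  - injection Htour as <- <- <-. exists C. split; [apply runs_nil|].
    split; [assumption|split; [assumption|intros q []]].
  - destruct (table_run w (region c) m s) as [[tr s1]|] eqn:Hrun; [|discriminate].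
    destruct (traversal_check c m s s1) eqn:Hcheck; [|discriminate].
    destruct (tour w ms (next c) s1) as [[[uv' c1] s2]|] eqn:Hrest; [|discriminate].
    injection Htour as <- <- <-.
    destruct (traverse Hcheck Hcovers Hdock Hrun) as (C1 & Hruns1 & Hcovers1 & Hdock1 & Hvisits1).
    destruct (IH _ _ _ _ _ _ Hrest Hcovers1 Hdock1) as (C2 & Hruns2 & Hcovers2 & Hdock2 & Hvisits2).
    exists C2.
    assert (Hblock : interlace_block (chart_words c tr :: uv') n =
        concat (repeat tr (copies n c)) ++ interlace_block uv' n)
      by (unfold interlace_block; cbn [flat_map]; now rewrite <- chart_words_block).
    rewrite Hblock, length_app.
    split; [eauto using runs_app|split; [assumption|split; [assumption|]]].
    intros q [Hq|Hq].
    + subst c. apply visits_before_le with (2 := Hvisits1 q eq_refl); lia.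
    + apply visits_before_app with C1; [exact (runs_end Hruns1)|now apply Hvisits2].
Qed.

(* When the square grows, every copy of [c] comes to lie over a copy, pushed outwards, of one
   of the parents of [c]. *)
Definition parents (c : chart) : list chart :=
  match c with
  | Corner q => [Corner q]
  | Side q => [Corner q; Side q; Corner (rot_ccw q)]
  end.

Definition growth_check (tb tb' : table) : bool :=
  forallb (fun q =>
    forallb (fun c => forallb (fun c' => shift_check (dom c) (push c') tb tb') (parents c))
      [Corner q; Side q])
    [DN; DE; DS; DW].

Lemma growth_check_spec tb tb' c c' p : growth_check tb tb' = true ->
  In c' (parents c) -> dom c p = true -> read tb' (addZ2 p (push c')) = read tb p.
Proof.
  intros Hcheck Hc' Hp. unfold growth_check in Hcheck. rewrite forallb_forall in Hcheck.
  apply (shift_check_spec (dom c)); [|assumption].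
  assert (Hq : forall q, In q [DN; DE; DS; DW]) by (intros []; cbn; auto).
  destruct c as [q|q]; specialize (Hcheck q (Hq q)); cbn [forallb] in Hcheck;
    apply andb_true_iff in Hcheck; destruct Hcheck as [Hcorner Hside];
    [|apply andb_true_iff in Hside; destruct Hside as [Hside _]].
  - rewrite forallb_forall in Hcorner. now apply Hcorner.
  - rewrite forallb_forall in Hside. now apply Hside.
Qed.

Lemma dom_parent c c' p : In c' (parents c) -> dom c p = true -> dom c' (addZ2 p (push c')) = true.
Proof.
  destruct p as [x y]. intros Hc' Hp.
  destruct c as [[]|[]]; cbn in Hc';
    repeat (destruct Hc' as [<-|Hc']; [chart_lia|]); destruct Hc'.
Qed.

Lemma offset_parent n c j : (j < copies (S n) c)%nat -> exists c' j',
  In c' (parents c) /\ (j' < copies n c')%nat /\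
  offset (S n) c j = addZ2 (push c') (offset n c' j').
Proof.
  intros Hj. destruct c as [q|q].
  - exists (Corner q), 0%nat. split; [now left|split; [cbn; lia|]].
    apply Z2_eq_iff. destruct q; chart_lia.
  - destruct (Nat.eq_dec j 0) as [->|Hfirst];
      [|destruct (Nat.eq_dec j (2 * n + 2)) as [->|Hlast]].
    + exists (Corner q), 0%nat. split; [now left|split; [cbn; lia|]].
      apply Z2_eq_iff. destruct q; chart_lia.
    + exists (Corner (rot_ccw q)), 0%nat. split; [cbn; auto|split; [cbn; lia|]].
      apply Z2_eq_iff. destruct q; chart_lia.
    + exists (Side q), (j - 1)%nat. split; [cbn; auto|split; [cbn in *; lia|]].
      apply Z2_eq_iff. cbn [copies] in Hj. destruct q; chart_lia.
Qed.

Lemma covers_grow n C tb tb' : growth_check tb tb' = true -> covers n C tb' -> covers (S n) C tb.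
Proof.
  intros Hcheck Hcovers c j Hj p Hp.
  destruct (offset_parent n c j Hj) as (c' & j' & Hc' & Hj' & ->).
  rewrite <- (growth_check_spec tb tb' c c' p Hcheck Hc' Hp).
  replace (addZ2 p (addZ2 (push c') (offset n c' j')))
    with (addZ2 (addZ2 p (push c')) (offset n c' j')) by z2_lia.
  apply Hcovers; [assumption|now apply dom_parent with c].
Qed.

Definition tour_words (w : list letter) (ms : list nat) (s0 : tconfig)
    : list (list nat * list nat) :=
  match tour w ms (Corner DS) s0 with Some (uv, _, _) => uv | None => [] end.

(* The tour ends with the corner where it began: there the ant moves on to the frame pushed
   outwards. *)
Definition cycle_check (w : list letter) (ms : list nat) (s0 : tconfig) : bool :=
  match tour w ms (Corner DS) s0 with
  | Some ((_ :: _, _) :: _, Side DS, s) =>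
      dockedb (push (Corner DS)) (config_of s) (config_of s0) &&
      growth_check (tab s0) (tab s) && (8 <=? length ms)%nat
  | _ => false
  end.

Definition frame_invariant (s0 : tconfig) (n : nat) (C : ant_config) : Prop :=
  covers n C (tab s0) /\ docked (base n (Corner DS)) C (config_of s0).

Lemma frame_invariant_0 s0 : frame_invariant s0 0 (config_of s0).
Proof.
  split; [|apply docked_config_of].
  intros c j Hj. replace (offset 0 c j) with ((0, 0) : Z * Z); [apply cells_agree_config_of|].
  destruct c as [q|q]; cbn [copies Nat.mul] in Hj; replace j with 0%nat by lia;
    now rewrite offset_0.
Qed.

Lemma itinerary_side q k : (8 <= k)%nat -> In (Side q) (itinerary (Corner DS) k).
Proof. intros Hk. do 8 (destruct k as [|k]; [lia|]). destruct q; cbn; tauto. Qed.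

Section Frame.

Variables (w : list letter) (ms : list nat) (s0 : tconfig).
Hypothesis checked : cycle_check w ms s0 = true.

Let uv := tour_words w ms s0.
Let C0 := config_of s0.

Lemma frame_cycle_visits n C : frame_invariant s0 n C ->
  exists C', runs w (near_frame n) C (interlace_block uv n) C' /\ frame_invariant s0 (S n) C' /\
    forall q, visits_before w C (length (interlace_block uv n)) n (Side q).
Proof.
  intros [Hcovers Hdock]. pose proof checked as Hcheck. unfold cycle_check in Hcheck.
  unfold uv, tour_words.
  destruct (tour w ms (Corner DS) s0) as [[[words c] s]|] eqn:Htour; [|discriminate].
  destruct words as [|[[|a u] v] words]; try discriminate.
  destruct c as [q|[]]; try discriminate.
  rewrite !andb_true_iff, Nat.leb_le in Hcheck. destruct Hcheck as [[Hmoved Hgrowth] Hturn].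
  apply dockedb_docked in Hmoved.
  destruct (tour_sound Htour Hcovers Hdock) as (C' & Hruns & Hcovers' & Hdock' & Hvisits).
  exists C'. split; [assumption|split; [split|]].
  - now apply covers_grow with (tab s).
  - pose proof (docked_trans Hdock' Hmoved) as Hdock''.
    replace (base (S n) (Corner DS)) with (addZ2 (base n (Side DS)) (push (Corner DS)))
      by (unfold base; rewrite Nat2Z.inj_succ; z2_lia).
    exact Hdock''.
  - intros q. now apply Hvisits, itinerary_side.
Qed.

Lemma frame_cycle n C : frame_invariant s0 n C ->
  exists C', runs w (near_frame n) C (interlace_block uv n) C' /\ frame_invariant s0 (S n) C'.
Proof.
  intros HC. destruct (frame_cycle_visits n C HC) as (C' & Hruns & HC' & _). now exists C'.
Qed.

Lemma frame_cycle_start_lt n : (cycle_start uv n < cycle_start uv (S n))%nat.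
Proof.
  rewrite cycle_start_succ.
  pose proof checked as Hcheck. unfold cycle_check in Hcheck. unfold uv, tour_words.
  destruct (tour w ms (Corner DS) s0) as [[[words c] s]|]; [|discriminate].
  destruct words as [|[[|a u] v] words]; try discriminate.
  unfold interlace_block. cbn. lia.
Qed.

Lemma frame_interlaced : interlaced (trace w C0).
Proof.
  exact (cycles_interlaced w uv (frame_invariant s0) near_frame C0 (frame_invariant_0 s0)
           frame_cycle frame_cycle_start_lt).
Qed.

Lemma frame_near n t : (cycle_start uv n <= t < cycle_start uv (S n))%nat ->
  near_frame n (trajectory w C0 t).
Proof.
  intros Ht. rewrite cycle_start_succ in Ht.
  replace t with (cycle_start uv n + (t - cycle_start uv n))%nat by lia.
  apply (cycles_trajectory w uv (frame_invariant s0) near_frame C0 (frame_invariant_0 s0)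
           frame_cycle). lia.
Qed.

Lemma frame_visits n q j : (j < copies n (Side q))%nat ->
  exists t, (cycle_start uv n <= t < cycle_start uv (S n))%nat /\
    placed inbox (offset n (Side q) j) (trajectory w C0 t).
Proof.
  intros Hj.
  destruct (frame_cycle_visits n (ant_iter w (cycle_start uv n) C0)) as (_ & _ & _ & Hvisits).
  { exact (cycle_start_inv w uv _ near_frame C0 (frame_invariant_0 s0) frame_cycle n). }
  destruct (Hvisits q j Hj) as (i & Hi & Hp). exists (cycle_start uv n + i)%nat.
  rewrite trajectory_add, cycle_start_succ. split; [lia|assumption].
Qed.

End Frame.

(** * Squares in the plane *)

Local Open Scope R_scope.

Definition supnorm (z : pt) : R := Rmax (Rabs (fst z)) (Rabs (snd z)).

Definition square (r : R) (z : pt) : Prop := supnorm z <= r.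

Lemma dist2_le p q a b :
  Rabs (fst p - fst q) <= a -> Rabs (snd p - snd q) <= b -> dist2 p q <= a + b.
Proof.
  intros Ha Hb. unfold dist2.
  pose proof (Rabs_pos (fst p - fst q)). pose proof (Rabs_pos (snd p - snd q)).
  rewrite <- (sqrt_pow2 (a + b)) by lra. apply sqrt_le_1_alt.
  rewrite <- (pow2_abs (fst p - fst q)), <- (pow2_abs (snd p - snd q)). nra.
Qed.

Lemma dist2_ge_fst p q : Rabs (fst p - fst q) <= dist2 p q.
Proof.
  unfold dist2. rewrite <- sqrt_Rsqr_abs. apply sqrt_le_1_alt.
  rewrite Rsqr_pow2. pose proof (pow2_ge_0 (snd p - snd q)). lra.
Qed.

Lemma dist2_ge_snd p q : Rabs (snd p - snd q) <= dist2 p q.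
Proof.
  unfold dist2. rewrite <- sqrt_Rsqr_abs. apply sqrt_le_1_alt.
  rewrite Rsqr_pow2. pose proof (pow2_ge_0 (fst p - fst q)). lra.
Qed.

Lemma dist2_diag p : dist2 p p = 0.
Proof.
  unfold dist2. rewrite !Rminus_diag. replace (0 ^ 2 + 0 ^ 2) with 0 by ring. exact sqrt_0.
Qed.

Lemma supnorm_lipschitz p q : Rabs (supnorm p - supnorm q) <= dist2 p q.
Proof.
  pose proof (dist2_ge_fst p q) as Hfst. pose proof (dist2_ge_snd p q) as Hsnd.
  unfold supnorm, Rmax.
  destruct (Rle_dec (Rabs (fst p)) (Rabs (snd p))), (Rle_dec (Rabs (fst q)) (Rabs (snd q)));
    split_Rabs; lra.
Qed.

Lemma supnorm_le r z : supnorm z <= r <-> Rabs (fst z) <= r /\ Rabs (snd z) <= r.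
Proof.
  unfold supnorm. split; [|intros [Hx Hy]; now apply Rmax_lub].
  intros Hr. split; eapply Rle_trans; try exact Hr; [apply Rmax_l|apply Rmax_r].
Qed.

Lemma square_compact r : 0 <= r -> compact_set (square r).
Proof.
  intros Hr. split.
  - intros p Hp. apply Rnot_lt_le. intros Hout.
    destruct (Hp (supnorm p - r)) as (q & Hq & Hdist); [lra|].
    pose proof (supnorm_lipschitz p q). unfold square in Hq. split_Rabs; lra.
  - exists (r + r). intros p Hp. apply supnorm_le in Hp.
    apply dist2_le; cbn [fst snd]; rewrite Rminus_0_r; apply Hp.
Qed.

Lemma square_rectangle r : 0 < r -> is_rectangle (square r).
Proof.
  intros Hr. exists (- r, - r), (2 * r, 0), (0, 2 * r). split; [|split; [|split]].
  - intros [= Heq]. lra.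
  - intros [= Heq]. lra.
  - cbn. ring.
  - intros [x y]. unfold square. rewrite supnorm_le. cbn [fst snd]. split.
    + intros [Hx Hy]. exists ((x + r) / (2 * r)), ((y + r) / (2 * r)).
      assert (Hunit : forall a, Rabs a <= r -> 0 <= (a + r) / (2 * r) <= 1).
      { intros a Ha. assert (Heq : (a + r) / (2 * r) * (2 * r) = a + r) by (field; lra).
        split_Rabs; nra. }
      split; [now apply Hunit|split; [now apply Hunit|f_equal; field; lra]].
    + intros (s & t & Hs & Ht & [= -> ->]). split; apply Rabs_le; nra.
Qed.

Lemma boundary_square r z : 0 <= r -> (boundary (square r) z <-> supnorm z = r).
Proof.
  intros Hr. split.
  - intros Hz. destruct (Rtotal_order (supnorm z) r) as [Hlt|[Heq|Hgt]]; [|assumption|].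
    + destruct (Hz (r - supnorm z)) as [_ (q & Hq & Hdist)]; [lra|].
      pose proof (supnorm_lipschitz z q). exfalso. apply Hq. unfold square. split_Rabs; lra.
    + destruct (Hz (supnorm z - r)) as [(q & Hq & Hdist) _]; [lra|].
      pose proof (supnorm_lipschitz z q). unfold square in Hq. split_Rabs; lra.
  - destruct z as [x y]. intros Hz eps Heps. split.
    { exists (x, y). rewrite dist2_diag. unfold square. lra. }
    assert (Hpush : forall a, exists a', Rabs (a - a') <= eps / 4 /\ Rabs a < Rabs a').
    { intros a. destruct (Rcase_abs a); [exists (a - eps / 4)|exists (a + eps / 4)];
        split; split_Rabs; lra. }
    destruct (Hpush x) as (x' & Hdx & Hx'), (Hpush y) as (y' & Hdy & Hy').
    exists (x', y'). split.
    + unfold square. rewrite supnorm_le. cbn [fst snd].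
      unfold supnorm, Rmax in Hz. cbn [fst snd] in Hz. destruct (Rle_dec _ _); lra.
    + pose proof (dist2_le (x, y) (x', y') _ _ Hdx Hdy). lra.
Qed.

Lemma dil_trans_square f r d p : 0 <= f -> 0 <= r ->
  (dil_trans f 0 d (square r) p <-> square (f * r) p).
Proof.
  intros Hf Hr. destruct p as [x y]. unfold dil_trans, square. setoid_rewrite supnorm_le.
  cbn [fst snd]. split.
  - intros ([u v] & [Hu Hv] & [= -> ->]). cbn [fst snd] in *.
    rewrite !Rmult_0_l, !Rplus_0_r, !Rabs_mult, (Rabs_pos_eq f Hf). nra.
  - intros [Hx Hy]. destruct (Rle_lt_or_eq_dec 0 f Hf) as [Hpos|<-].
    + assert (Hscale : forall a, Rabs a <= f * r -> Rabs (a / f) <= r).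
      { intros a Ha. apply Rmult_le_reg_l with f; [assumption|].
        rewrite <- (Rabs_pos_eq f Hf) at 1. rewrite <- Rabs_mult.
        now replace (f * (a / f)) with a by (field; lra). }
      exists (x / f, y / f). cbn [fst snd]. split; [auto|]. f_equal; field; lra.
    + exists (0, 0). cbn [fst snd]. rewrite Rabs_R0, Rmult_0_l in *.
      split; [lra|]. f_equal; split_Rabs; lra.
Qed.

Lemma boundary_dilated_square f r d p : 0 <= f -> 0 <= r -> supnorm p = f * r ->
  boundary (dil_trans f 0 d (square r)) p.
Proof.
  intros Hf Hr Hp eps Heps.
  destruct (proj2 (boundary_square (f * r) p ltac:(nra)) Hp eps Heps) as [Hin Hout].
  setoid_rewrite (dil_trans_square f r d _ Hf Hr). now split.
Qed.

Lemma offset_supnorm n c j : (j < copies n c)%nat -> supnorm (toR2 (offset n c j)) = INR n * 2.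
Proof.
  intros Hj. unfold supnorm, toR2. cbn [fst snd]. rewrite !Rabs_Zabs, INR_IZR_INZ, <- mult_IZR.
  assert (Hmax : Z.max (Z.abs (fst (offset n c j))) (Z.abs (snd (offset n c j))) =
      (Z.of_nat n * 2)%Z) by (destruct c as [[]|[]]; chart_lia).
  rewrite <- Hmax. unfold Rmax. destruct (Rle_dec _ _) as [Hle|Hgt]; f_equal.
  - apply le_IZR in Hle. lia.
  - assert (~ (Z.abs (fst (offset n c j)) <= Z.abs (snd (offset n c j)))%Z)
      by (intros Hle; apply Hgt, IZR_le, Hle). lia.
Qed.

Lemma placed_inbox_dist2 o p z : placed inbox o p ->
  Rabs (IZR (fst o) - fst z) <= 2 -> Rabs (IZR (snd o) - snd z) <= 2 ->
  dist2 (toR2 p) z <= 122.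
Proof.
  intros ([x y] & Hq & ->) Hfst Hsnd. unfold inbox in Hq. cbn [fst snd] in Hq.
  assert (Hx : (0 <= x <= 74)%Z) by lia. assert (Hy : (0 <= y <= 44)%Z) by lia.
  destruct Hx as [Hx1 Hx2], Hy as [Hy1 Hy2]. apply IZR_le in Hx1, Hx2, Hy1, Hy2.
  replace 122 with (76 + 46) by ring.
  apply dist2_le; unfold toR2, addZ2; cbn [fst snd]; rewrite plus_IZR; split_Rabs; lra.
Qed.

Lemma even_nat_near t n : 0 <= t <= 4 * INR n ->
  exists j, (j < S (2 * n))%nat /\ Rabs (2 * INR j - t) <= 2.
Proof.
  intros Ht. pose proof (Zfloor_bound (t / 2)) as Hfloor. set (k := Zfloor (t / 2)) in *.
  assert (Hk : (-1 < k)%Z) by (apply lt_IZR; lra).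
  assert (Hkn : (k <= 2 * Z.of_nat n)%Z) by (apply le_IZR; rewrite mult_IZR, <- INR_IZR_INZ; lra).
  exists (Z.to_nat k). split; [lia|].
  rewrite INR_IZR_INZ, Z2Nat.id by lia. apply Rabs_le. lra.
Qed.

Lemma offset_side n q j :
  offset n (Side q) j = (match q with
    | DS => (2 * Z.of_nat j - 2 * Z.of_nat n, - (2 * Z.of_nat n))
    | DE => (2 * Z.of_nat n, 2 * Z.of_nat j - 2 * Z.of_nat n)
    | DN => (2 * Z.of_nat n - 2 * Z.of_nat j, 2 * Z.of_nat n)
    | DW => (- (2 * Z.of_nat n), 2 * Z.of_nat n - 2 * Z.of_nat j)
    end)%Z.
Proof. destruct q; apply Z2_eq_iff; chart_lia. Qed.

Lemma side_dense n z : supnorm z = 2 * INR n -> exists q j, (j < copies n (Side q))%nat /\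
  Rabs (IZR (fst (offset n (Side q) j)) - fst z) <= 2 /\
  Rabs (IZR (snd (offset n (Side q) j)) - snd z) <= 2.
Proof.
  destruct z as [x y]. intros Hz.
  assert (Hle : supnorm (x, y) <= 2 * INR n) by lra. apply supnorm_le in Hle.
  assert (Hedge : exists q t, 0 <= t <= 4 * INR n /\
    (x, y) = match q with
             | DS => (t - 2 * INR n, - (2 * INR n))
             | DE => (2 * INR n, t - 2 * INR n)
             | DN => (2 * INR n - t, 2 * INR n)
             | DW => (- (2 * INR n), 2 * INR n - t)
             end).
  { unfold supnorm, Rmax in Hz. cbn [fst snd] in Hz, Hle.
    destruct (Rle_dec _ _);
      [destruct (Rcase_abs y); [exists DS, (x + 2 * INR n)|exists DN, (2 * INR n - x)]
      |destruct (Rcase_abs x); [exists DW, (2 * INR n - y)|exists DE, (y + 2 * INR n)]];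
      (split; [|f_equal]; split_Rabs; lra). }
  destruct Hedge as (q & t & Ht & Heq). destruct (even_nat_near t n Ht) as (j & Hj & Hnear).
  exists q, j. split; [exact Hj|]. rewrite offset_side.
  destruct q; injection Heq as -> ->; cbn [fst snd];
    rewrite ?opp_IZR, ?minus_IZR, ?mult_IZR, <- ?INR_IZR_INZ; split; split_Rabs; lra.
Qed.

Lemma frame_increasing_rectangle w ms s0 :
  cycle_check w ms s0 = true ->
  increasing_rectangle_behaviour w (config_of s0).
Proof.
  intros Hcheck.
  set (start := cycle_start (tour_words w ms s0)).
  assert (Hstart : forall n, (start n < start (S n))%nat)
    by exact (frame_cycle_start_lt w ms s0 Hcheck).
  split; [exists 0%nat; exact (frame_interlaced w ms s0 Hcheck)|].
  exists (square 2), (fun t => INR (stage start t)), (fun _ => 0), 122%Z, (1, 0).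
  split; [apply square_compact; lra|].
  split; [unfold square; rewrite supnorm_le; cbn [fst snd]; rewrite Rabs_R0; lra|].
  split; [apply square_rectangle; lra|].
  split; [|split; [now apply stage_tends_to_infty|]].
  - apply previsible_of_stages; auto; [intros [= Heq]; lra| |].
    + intros n t Ht.
      destruct (frame_near w ms s0 Hcheck n t Ht) as (c & j & Hj & q & Hq & Hp).
      exists (toR2 (offset n c j)). split.
      * apply boundary_dilated_square; [apply pos_INR|lra|now apply offset_supnorm].
      * apply (placed_inbox_dist2 (offset n c j)).
        -- exists q. apply andb_true_iff in Hq. now split.
        -- unfold toR2. cbn [fst]. rewrite Rminus_diag, Rabs_R0. lra.
        -- unfold toR2. cbn [snd]. rewrite Rminus_diag, Rabs_R0. lra.
    + intros p n Hp. apply boundary_square in Hp; [|lra].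
      destruct (side_dense n (INR n * fst p, INR n * snd p)) as (q & j & Hj & Hfst & Hsnd).
      { unfold supnorm in *. cbn [fst snd].
        rewrite !Rabs_mult, (Rabs_pos_eq _ (pos_INR n)), RmaxRmult, Hp by apply pos_INR. ring. }
      destruct (frame_visits w ms s0 Hcheck n q j Hj) as (t & Ht & Hvisit).
      exists t. split; [exact Ht|]. now apply (placed_inbox_dist2 (offset n (Side q) j)).
  - intros Hinf. destruct (Hinf 1) as [N HN]. specialize (HN N (Nat.le_refl N)). lra.
Qed.

Local Open Scope Z_scope.

Definition table_square : table :=
  picture ([
    "00000000000000000000000000000000000000000000000000000000000000000000000000";
    "00000000000000000000000000000000000000000000000000000000000000000000000000";
    "00000000000000000000000000000000000000000000000000000000000000000000000000";
    "00000000000000000000000000000000000000000000000000000000000000000000000000";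
    "00000111111111111111111111111111111111111111111111111111111111111111100000";
    "00001243333333333333333333333333333333333333333333333333333333333334210000";
    "00001445444444444444444444444444444444444444444444444444444444444454410000";
    "00001354544444444444444444444444444444444444444444444444444444444545310000";
    "00001345454444444444444444444444444444444444444444444444444444445454310000";
    "00001344545444444444444444444444444444444444444444444444444444454544310000";
    "00001344454544444444444444444444444444444444444444444444444444545444310000";
    "00001344445454444444444444444444444444444444444444444444444445454444310000";
    "00001344444545444444444444444444444444444444444444444444444454544444310000";
    "00001344444454544444444444444444444444444444444444444444444545444444310000";
    "00001344444445454444444444444444444444444444444444444444445454444444310000";
    "00001344444444545444444444444444444444444444444444444444454544444444310000";
    "00001344444444454544444444444444444444444444444444444444545444444444310000";
    "00001344444444445454444444444444444444444444444444444445454444444444310000";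
    "00001344444444445454251544545454145444444444444545424445454444444444310000";
    "00001344444444454543552515454541454444444444444454542444545444444444310000";
    "00001344444444545425154454545414544444444444444445454244454544444444310000";
    "00001344444445454355251545454145444444444444444444545424445454444444310000";
    "00001344444454542515445454541454444444444444444444454542444545444444310000";
    "00001344444545435525154545414544444444444444444444445454244454544444310000";
    "00001344445454251544545454145444444444444444444444444545424445454444310000";
    "00001344454543552515454541454444444444444444444444444454542444545444310000";
    "00001344545425154454545414544444444444444444444444444445454244454544310000";
    "00001345454355251545454145444444444444444444444444444444545424445454310000";
    "00001354542515445454541454444444444444444444444444444444454542444545310000";
    "00001445435525154545414544444444444444444444444444444444445454244454410000";
    "00001243251544545454145444444444444444444444444444444444444545423334210000";
    "00000111352515454541454444444444444444444444444444444444444454531111100000";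
    "00000001443354544314544444444444444444444444444444444444444445441000000000";
    "00000001414333221035444444444333333333333333333333333333333333421000000000";
    "00000001530110055122222222222111111111111111111111111111111111110000000000";
    "00000001535050551000000000000000000000000000000000000000000000000000000000";
    "00000002035505510000000000000000000000000000000000000000000000000000000000";
    "00000002033335100000000000000000000000000000000000000000000000000000000000";
    "00000001400531000000000000000000000000000000000000000000000000000000000000";
    "00000001122110000000000000000000000000000000000000000000000000000000000000";
    "00000000000000000000000000000000000000000000000000000000000000000000000000";
    "00000000000000000000000000000000000000000000000000000000000000000000000000";
    "00000000000000000000000000000000000000000000000000000000000000000000000000";
    "00000000000000000000000000000000000000000000000000000000000000000000000000" ])%string.

Definition start_square : tconfig := TConfig table_square (29, 9) DE.

Definition tour_square : list nat :=
  [ 24; 4; 77; 4; 77; 4; 97; 4; 177; 4; 89; 4; 85; 4; 105; 4; 121; 4; 81; 4; 81; 4; 101; 4;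
    149; 4; 93; 4; 89; 4; 109; 4; 149 ]%nat.

Lemma growing_square : exists C : ant_config,
  finite_config w_LLRRRL C /\ increasing_rectangle_behaviour w_LLRRRL C.
Proof.
  exists (config_of start_square). split.
  - apply config_of_finite; vm_compute; [lia|reflexivity].
  - apply (frame_increasing_rectangle _ tour_square). vm_compute. reflexivity.
Qed.

Theorem theorem1 :
  (exists (C : ant_config) (n : nat) (a b : Z),
      is_highway w_LLRRRL C n a b /\ ~ diagonal_drift a b) /\
  (exists C : ant_config,
      finite_config w_LLRRRL C /\ increasing_rectangle_behaviour w_LLRRRL C) /\
  (exists H : nat -> ant_config,
      (forall i, exists (n : nat) (a b : Z),
          is_highway w_LLRRRL (H i) n a b /\ diagonal_drift a b) /\
      (forall i j, i <> j -> ~ highway_equiv w_LLRRRL (H i) (H j))).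
Proof.
  split; [exact vertical_highway|split; [exact growing_square|exact diagonal_highways]].
Qed.
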